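(* A generic $\ell\times\ell$ monic linear pencil $L\in\mathbb{R}^{\ell\times\ell}\langle x,x^*\rangle$ in $g>2$ variables has the zero determining property $\mathcal Z(\widehat{\partial\mathcal D}_L^\circ)=V(L)$.
   Context: Let $x=(x_1,\dots,x_g)$ and let $\mathbb{R}\langle x,x^*\rangle$ be the free real algebra on the $2g$ noncommuting letters $x_i,x_i^*$, with the linear involution $*$ exchanging $x_i$ and $x_i^*$ and satisfying $(pq)^*=q^*p^*$. A matrix polynomial $p=\sum_wA_w\otimes w$ has $p^*=\sum_wA_w^*\otimes w^*$ ($A^*$ = transpose) and is evaluated at a tuple $X$ of real $n\times n$ matrices by $p(X)=\sum_wA_w\otimes w(X)$ (Kronecker product), with $x_i\mapsto X_i$, $x_i^*\mapsto X_i^*$ (transpose), empty word $\mapsto\mathrm{Id}_n$. A monic $\ell\times\ell$ linear pencil is $L=\mathrm{Id}_\ell+\sum_{i=1}^g(A_i\otimes x_i+A_i^*\otimes x_i^* )$ with $A_i\in\mathbb{R}^{\ell\times\ell}$. ''Generic'' means: for all coefficient tuples $(A_1,\dots,A_g)\in(\mathbb{R}^{\ell\times\ell})^g$ outside some proper algebraic subset. $\mathcal D_L^\circ(n)$ is the connected component of $0$ in $\{X\in(\mathbb{R}^{n\times n})^g:L(X)\succ0\}$, $\mathcal D_L^\circ=\bigcup_n\mathcal D_L^\circ(n)$, and $\widehat{\partial\mathcal D}_L^\circ=\{(X,v):X\in\overline{\mathcal D_L^\circ},\ L(X)v=0\}$ (closure for each $n$; $v\in\mathbb{R}^{\ell n}$).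 $V(L)=\{(X,v):L(X)v=0\}$ (over all $n$). For $W\subseteq\bigcup_n(\mathbb{R}^{n\times n})^g\times\mathbb{R}^{\ell n}$, $\mathcal I(W)=\{p\in\mathbb{R}^{1\times\ell}\langle x,x^*\rangle:p(X)v=0\ \forall(X,v)\in W\}$ and $\mathcal Z(W)=\{(X,v):p(X)v=0\ \forall p\in\mathcal I(W)\}$. *)

(* Defs.v *)
From HB Require Import structures.
From mathcomp Require Import all_boot all_order all_algebra.
From mathcomp Require Import finmap.
(* The notations of monalg and mpoly clash with those of analysis. *)
From mathcomp.multinomials Require Import -(notations) mpoly monalg.
From mathcomp Require Import all_classical all_reals all_analysis.
From mathcomp.real_closed Require Import mxtens.

Set Implicit Arguments.
Unset Strict Implicit.
Unset Printing Implicit Defensive.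

Import Order.TTheory GRing.Theory Num.Theory.
Import numFieldNormedType.Exports.

Local Open Scope classical_set_scope.
Local Open Scope ring_scope.

(* A g-tuple of n x n matrices, as a row of matrices: this carries the
   product topology of (R^{n x n})^g. *)
Definition mxtuple (R : realType) (g n : nat) := 'rV['M[R]_n]_g.

Section NCPolynomials.
Variables (R : realType) (g : nat).

(* inl i stands for x_i, inr i for x_i^* *)
Definition letter := ('I_g + 'I_g)%type.

Definition word : Type := fmonom letter.

(* The a x b matrix polynomials sum_w A_w (x) w in R^{a x b}<x,x^*>, i.e. the
   finitely supported families (A_w)_w of real a x b matrices. *)
Definition ncpoly (a b : nat) := @malg word 'M[R]_(a, b).

Definition letter_eval n (X : mxtuple R g n) (c : letter) : 'M[R]_n :=
  match c with inl i => X 0 i | inr i => (X 0 i)^T end.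

Definition word_eval n (X : mxtuple R g n) (w : word) : 'M[R]_n :=
  \big[mulmx/1%:M]_(c <- fmonom_val w) letter_eval X c.

(* *t is the Kronecker product *)
Definition nceval a b (p : ncpoly a b) n (X : mxtuple R g n) :
    'M[R]_(a * n, b * n) :=
  \sum_(w <- msupp p) mcoeff w p *t word_eval X w.

Definition monomial a b (A : 'M[R]_(a, b)) (s : seq letter) : ncpoly a b :=
  mkmalgU (FMonom s) A.

Definition monic_pencil l (A : mxtuple R g l) : ncpoly l l :=
  monomial 1%:M [::] +
  \sum_(i < g) (monomial (A 0 i) [:: inl i] + monomial (A 0 i)^T [:: inr i]).

Definition posdefmx m (M : 'M[R]_m) : Prop :=
  M^T = M /\ forall u : 'cV[R]_m, u != 0 -> 0 < (u^T *m M *m u) 0 0.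

Variable l : nat.

(* Subsets of the union over n of (R^{n x n})^g x R^{ln}, as families indexed
   by n. The degenerate level n = 0 imposes no condition anywhere below, since
   R^{l0} = {0}. *)
Definition levelset := forall n, set (mxtuple R g n * 'cV[R]_(l * n)).

Section Pencil.
Variable L : ncpoly l l.

Definition posdomain n : set (mxtuple R g n) :=
  connected_component [set X | posdefmx (nceval L X)] 0.

Definition detailed_boundary : levelset := fun n =>
  [set Xv | closure (@posdomain n) Xv.1 /\ nceval L Xv.1 *m Xv.2 = 0].

Definition pencil_variety : levelset := fun n =>
  [set Xv | nceval L Xv.1 *m Xv.2 = 0].

End Pencil.

Definition vanishing_ideal (W : levelset) : set (ncpoly 1 l) :=
  [set p | forall n Xv, W n Xv -> nceval p Xv.1 *m Xv.2 = 0].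

Definition zero_closure (W : levelset) : levelset := fun n =>
  [set Xv | forall p, vanishing_ideal W p -> nceval p Xv.1 *m Xv.2 = 0].

Definition zero_determining (L : ncpoly l l) : Prop :=
  zero_closure (detailed_boundary L) = pencil_variety L.

End NCPolynomials.

Section Generic.
Variables (R : realType) (g l : nat).

Definition entry_index : finType := ('I_g * ('I_l * 'I_l))%type.

Definition entries (A : mxtuple R g l) (k : 'I_#|entry_index|) : R :=
  let e := enum_val k in A 0 e.1 e.2.1 e.2.2.

(* common zero sets of real polynomials in the g l^2 matrix entries *)
Definition algebraic_subset (S : set (mxtuple R g l)) : Prop :=
  exists P : set (mpoly #|entry_index| R),
    S = [set A | forall p, P p -> meval (entries A) p = 0].

Definition generically (Q : mxtuple R g l -> Prop) : Prop :=
  exists S, [/\ algebraic_subset S, S <> setT & forall A, ~ S A -> Q A].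

End Generic.

(* Main.v *)
Require Import Defs.
From HB Require Import structures.
From mathcomp Require Import all_boot all_order all_algebra.
From mathcomp Require Import finmap.
From mathcomp.multinomials Require Import -(notations) mpoly monalg.
From mathcomp Require Import all_classical all_reals all_analysis.
From mathcomp.real_closed Require Import mxtens.
From mathcomp Require Import ring lra.

Set Implicit Arguments.
Unset Strict Implicit.
Unset Printing Implicit Defensive.

Import Order.TTheory GRing.Theory Num.Theory.
Import numFieldNormedType.Exports.

Local Open Scope classical_set_scope.
Local Open Scope ring_scope.

(** Write a vector of R^{ln} as an l x n matrix V; then A (x) X acts on it as
    V |-> A V X^T, and L(X) v = 0 becomes the equation

      V + sum_i (A_i V X_i^T + A_i^T V X_i) = 0.                         (E)

    One inclusion is immediate: the rows of L vanish on the boundary, hence on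
    its zero closure.  For the other one, let p vanish on the boundary and let
    (X, v) be any point of V(L).  The idea is to join (X, v), after adding a
    fixed direct summand, to a boundary point by a polynomial path inside V(L)
    whose beginning stays in the boundary.  Then p(X(t)) v(t) is polynomial in
    t and zero for small t, hence zero at the far end, and the direct summand
    is dropped.

    The fixed summand comes from Perron-Frobenius theory.  The map
    Phi(V) = sum_i (A_i V A_i^T + A_i^T V A_i) is self-adjoint and completely
    positive, and generic A_i generate the full matrix algebra, so its largest
    eigenvalue lam is simple, with a positive definite eigenvector P
    ([perron_frobenius]).  Equation (E) at X0_i = - A_i / lam says that V is
    fixed by Phi / lam, so L(X0) is positive semidefinite with kernel spanned
    by P, an l x l matrix of full rank.

    The path starts at (0 (+) X0, [0, P]), ends at (X (+) X0, [V, P]) and has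
    [tV, P] as its vector.  Since (E) is affine in the tuple, one only has to
    correct the naive tuple tX (+) X0: the error in the first n columns is
    absorbed by an off-diagonal block, as A_1 and P are invertible, and what
    remains by the lower diagonal block ([perturbation_surj]).  The latter works
    because the adjoint system, Z A_i + A_i Z^T = 0 for all i, has only the zero
    solution: such a Z commutes with A_2 A_1^{-1} and A_3 A_1^{-1}, which
    generically generate all matrices; this is where three variables are used.

    At the start of the path the kernel is one-dimensional, and the path never
    leaves V(L); hence L(X(t)) remains positive semidefinite for small t
    ([simple_kernel_stable]).  Positive semidefinite points of V(L) are in the
    boundary because L is positive definite on the segment s X(t), s < 1
    ([psd_boundary]).

    All the genericity used is the nonvanishing of three determinants
    ([generic_poly]), which holds for A_1 = 1, A_2 diagonal with distinct
    entries and A_3 the all-ones matrix. *)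

(** * The Frobenius inner product and extremal problems on its unit sphere *)

Lemma mx_cvg (S : Type) (F : set_system S) (FF : Filter F) (T : topologicalType)
    m n (f : S -> 'M[T]_(m, n)) (M : 'M[T]_(m, n)) :
  (forall i j, f x i j @[x --> F] --> M i j) -> f @ F --> M.
Proof.
move=> fM A [P MP PA].
have /(filterS _) : F [set x | forall i j, P i j (f x i j)].
  apply: filter_forall => i; apply: filter_forall => j.
  exact: (fM i j _ (MP i j)).
by apply => x Px; exact: PA.
Qed.

Section Frobenius.
Variable R : realType.

Definition mxdot p q (V W : 'M[R]_(p, q)) : R := \tr (V^T *m W).

Lemma mxdotE p q (V W : 'M[R]_(p, q)) :
  mxdot V W = \sum_i \sum_j V i j * W i j.
Proof.
rewrite /mxdot /mxtrace exchange_big; apply: eq_bigr => j _.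
by rewrite !mxE; apply: eq_bigr => i _; rewrite mxE.
Qed.

Lemma mxdotC p q (V W : 'M[R]_(p, q)) : mxdot V W = mxdot W V.
Proof. by rewrite !mxdotE; do 2![apply: eq_bigr => ? _]; rewrite mulrC. Qed.

Lemma mxdotDr p q (V W Z : 'M[R]_(p, q)) : mxdot V (W + Z) = mxdot V W + mxdot V Z.
Proof. by rewrite /mxdot mulmxDr mxtraceD. Qed.

Lemma mxdotZr p q a (V W : 'M[R]_(p, q)) : mxdot V (a *: W) = a * mxdot V W.
Proof. by rewrite /mxdot -scalemxAr mxtraceZ. Qed.

Lemma mxdotDl p q (V W Z : 'M[R]_(p, q)) : mxdot (V + W) Z = mxdot V Z + mxdot W Z.
Proof. by rewrite mxdotC mxdotDr !(mxdotC Z). Qed.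

Lemma mxdotZl p q a (V W : 'M[R]_(p, q)) : mxdot (a *: V) W = a * mxdot V W.
Proof. by rewrite mxdotC mxdotZr mxdotC. Qed.

Lemma mxdotNr p q (V W : 'M[R]_(p, q)) : mxdot V (- W) = - mxdot V W.
Proof. by rewrite -scaleN1r mxdotZr mulN1r. Qed.

Lemma mxdotBr p q (V W Z : 'M[R]_(p, q)) : mxdot V (W - Z) = mxdot V W - mxdot V Z.
Proof. by rewrite mxdotDr mxdotNr. Qed.

Lemma mxdot0r p q (V : 'M[R]_(p, q)) : mxdot V 0 = 0.
Proof. by rewrite /mxdot mulmx0 mxtrace0. Qed.

Lemma mxdot_sumr p q (I : finType) (V : 'M[R]_(p, q)) (F : I -> 'M[R]_(p, q)) :
  mxdot V (\sum_i F i) = \sum_i mxdot V (F i).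
Proof. by rewrite /mxdot mulmx_sumr raddf_sum. Qed.

Lemma mxdot_ge0 p q (V : 'M[R]_(p, q)) : 0 <= mxdot V V.
Proof. by rewrite mxdotE; do 2![apply: sumr_ge0 => ? _]; rewrite -expr2 sqr_ge0. Qed.

Lemma mxdot_eq0 p q (V : 'M[R]_(p, q)) : mxdot V V = 0 -> V = 0.
Proof.
have h i : 0 <= \sum_j V i j * V i j.
  by apply: sumr_ge0 => ? _; rewrite -expr2 sqr_ge0.
rewrite mxdotE => /eqP; rewrite psumr_eq0 // => /allP V0.
apply/matrixP => i j; rewrite mxE.
have /= := V0 i (mem_index_enum _).
rewrite psumr_eq0 => [/allP /(_ j (mem_index_enum _))/=|k _].
  by rewrite -expr2 sqrf_eq0 => /eqP.
by rewrite -expr2 sqr_ge0.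
Qed.

Lemma mxdot_gt0 p q (V : 'M[R]_(p, q)) : V != 0 -> 0 < mxdot V V.
Proof.
move=> V0; rewrite lt_neqAle mxdot_ge0 andbT eq_sym.
by apply: contra_neq V0 => /mxdot_eq0.
Qed.

Lemma mxdot_mulmxl p q r (M : 'M[R]_(r, p)) (V : 'M[R]_(r, q)) (W : 'M[R]_(p, q)) :
  mxdot V (M *m W) = mxdot (M^T *m V) W.
Proof. by rewrite /mxdot trmx_mul trmxK mulmxA. Qed.

Lemma mxdot_mulmxr p q r (M : 'M[R]_(r, q)) (V : 'M[R]_(p, q)) (W : 'M[R]_(p, r)) :
  mxdot V (W *m M) = mxdot (V *m M^T) W.
Proof. by rewrite /mxdot trmx_mul trmxK mulmxA mxtrace_mulC mulmxA. Qed.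

Lemma quad_mxdot m (M : 'M[R]_m) (u : 'cV[R]_m) :
  (u^T *m M *m u) 0 0 = mxdot u (M *m u).
Proof. by rewrite /mxdot -mulmxA [u^T *m _]mx11_scalar mxtrace_scalar mxE mulr1n. Qed.

Lemma mxdot_coord p q (V : 'M[R]_(p, q)) i j : `|V i j| ^+ 2 <= mxdot V V.
Proof.
rewrite mxdotE (bigD1 i) //= (bigD1 j) //= real_normK ?num_real// expr2.
rewrite -addrA lerDl addr_ge0 //.
  by apply: sumr_ge0 => ? _; rewrite -expr2 sqr_ge0.
by do 2![apply: sumr_ge0 => ? _]; rewrite -expr2 sqr_ge0.
Qed.

Lemma sum_continuous (T : topologicalType) (I : finType) (f : I -> T -> R) :
  (forall i, continuous (f i)) -> continuous (fun x => \sum_i f i x).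
Proof.
move=> fc x; apply: cvg_big => [|i _]; last exact: fc.
exact: add_continuous.
Qed.

Lemma mulr_fun_continuous (T : topologicalType) (f g : T -> R) :
  continuous f -> continuous g -> continuous (fun x => f x * g x).
Proof. by move=> fc gc x; apply: cvgM; [exact: fc|exact: gc]. Qed.

Lemma mxlinear_continuous p q (f : 'M[R]_(p, q) -> R) :
  scalar f -> continuous f.
Proof.
move=> flin.
have fD U V : f (U + V) = f U + f V by rewrite -{1}[U]scale1r flin mul1r.
have f0 : f 0 = 0 by apply: (addrI (f 0)); rewrite -fD !addr0.
have fZ a V : f (a *: V) = a * f V by rewrite -[a *: V]addr0 flin f0 addr0.
have -> : f =
    fun V => \sum_i \sum_j V i j * f (delta_mx i j).
  apply/funext => V; rewrite {1}(matrix_sum_delta V) (big_morph f fD f0).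
  apply: eq_bigr => i _; rewrite (big_morph f fD f0).
  by apply: eq_bigr => j _; rewrite fZ.
apply: sum_continuous => i; apply: sum_continuous => j.
by apply: mulr_fun_continuous; [exact: coord_continuous|exact: cst_continuous].
Qed.

Lemma mxcoord_continuous p q p' q' (T : {linear 'M[R]_(p, q) -> 'M[R]_(p', q')}) i j :
  continuous (fun V : 'M[R]_(p, q) => T V i j).
Proof.
by apply: mxlinear_continuous => a U V; rewrite linearP !mxE.
Qed.

Lemma quad_continuous p q (T : {linear 'M[R]_(p, q) -> 'M[R]_(p, q)}) :
  continuous (fun V => mxdot V (T V)).
Proof.
have -> : (fun V => mxdot V (T V)) = fun V => \sum_i \sum_j V i j * T V i j.
  by apply/funext => V; rewrite mxdotE.
apply: sum_continuous => i; apply: sum_continuous => j.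
by apply: mulr_fun_continuous; [exact: coord_continuous|exact: mxcoord_continuous].
Qed.

Definition sphere p q : set 'M[R]_(p, q) := [set V | mxdot V V = 1].

Lemma closed_sphere p q : closed (@sphere p q).
Proof.
have -> : @sphere p q = (fun V => mxdot V (idfun V)) @^-1` [set 1] by [].
apply: closed_comp; last exact: closed_eq.
by move=> V _; exact: (@quad_continuous _ _ idfun).
Qed.

(** A closed subset of the sphere is compact: [vec_mx] identifies it with a
    closed bounded set of row vectors. *)
Lemma sphere_max p q (A : set 'M[R]_(p, q)) (f : 'M[R]_(p, q) -> R) :
    closed A -> A !=set0 -> A `<=` @sphere p q ->
    {in A, continuous f} ->
  exists2 V, A V & forall W, A W -> f W <= f V.
Proof.
move=> Acl [V0 AV0] Asph fcont.
have cvec : continuous (@vec_mx R p q).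
  move=> v; apply: (mx_cvg (nbhs_filter v)) => i j.
  exact: (@mxcoord_continuous _ _ _ _ (@vec_mx R p q)).
pose A' := @vec_mx R p q @^-1` A.
have cA' : compact A'.
  apply: bounded_closed_compact; last by apply: closed_comp Acl => v _; exact: cvec.
  exists 1; split; first exact: num_real.
  move=> M M1 v /Asph; rewrite /sphere /= => v1.
  rewrite [leLHS]mx_normrE; apply/bigmax_leP; split=> [|[i j] _].
    by apply: le_trans (ltW M1).
  apply: le_trans (ltW M1); rewrite /= -(@expr_le1 _ 2)//.
  rewrite -v1 -{1}(vec_mxK v) (ord1 i); case/mxvec_indexP: j => i' j'.
  by rewrite mxvecE mxdot_coord.
have nA' : A' !=set0 by exists (mxvec V0); rewrite /A' /= mxvecK.
have cf : {within A', continuous (f \o vec_mx)}.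
  apply: continuous_in_subspaceT => v; rewrite inE => Av.
  apply: continuous_comp; first exact: cvec.
  by apply: fcont; rewrite inE.
have [v Av vmax] := compact_EVT_max nA' cA' cf.
exists (vec_mx v); first by move: Av; rewrite inE.
move=> W AW; have := vmax (mxvec W); rewrite /= mxvecK; apply.
by rewrite inE /A' /= mxvecK.
Qed.

(** The largest eigenvalue of T relative to the positive form D, in variational
    form: the quotient of the two forms attains its maximum on the sphere. *)
Lemma rayleigh p q (T D : {linear 'M[R]_(p, q) -> 'M[R]_(p, q)}) (Z : 'M[R]_(p, q)) :
    Z != 0 -> (forall V, V != 0 -> 0 < mxdot V (D V)) ->
  exists tau, exists2 V, V != 0 /\ mxdot V (T V) = tau * mxdot V (D V) &
    forall W, mxdot W (T W) <= tau * mxdot W (D W).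
Proof.
move=> Z0 Dpos; pose f V := mxdot V (T V) / mxdot V (D V).
have nz V : sphere V -> V != 0.
  by move=> V1; apply: contra_eqN V1 => /eqP ->; rewrite mxdot0r eq_sym oner_eq0.
have norm V : V != 0 -> exists2 a, a != 0 & sphere (a *: V).
  move=> V0; exists (Num.sqrt (mxdot V V))^-1.
    by rewrite invr_eq0 sqrtr_eq0 -ltNge mxdot_gt0.
  rewrite /sphere /= mxdotZr mxdotZl mulrA -invfM -expr2 sqr_sqrtr ?mxdot_ge0//.
  by rewrite mulVf // gt_eqF // mxdot_gt0.
have [a a0 aZ] := norm _ _ Z Z0.
have [||||V V1 Vmax] := @sphere_max p q (@sphere p q) f.
- exact: closed_sphere.
- by exists (a *: Z).
- by [].
- move=> V; rewrite inE => V1.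
  apply: (@continuousM _ _ _ _ V); first exact: quad_continuous.
  apply: (@continuousV _ _ _ V); last exact: quad_continuous.
  by rewrite gt_eqF// Dpos// nz.
exists (f V), V; first by split; [exact: nz|rewrite mulfVK// gt_eqF// Dpos// nz].
move=> W; have [->|W0] := eqVneq W 0; first by rewrite !linear0 !mxdot0r mulr0.
have [b b0 bW] := norm _ _ W W0.
have := Vmax _ bW; rewrite {1}/f !linearZ /= !mxdotZr !mxdotZl !mulrA.
rewrite -expr2 -mulf_div divff ?sqrf_eq0// mul1r.
by rewrite ler_pdivrMr// Dpos.
Qed.

End Frobenius.

(** * Positive semidefinite matrices *)

Section Psd.
Variable R : realType.

Lemma mxdot0l p q (V : 'M[R]_(p, q)) : mxdot 0 V = 0.
Proof. by rewrite mxdotC mxdot0r. Qed.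

Lemma first_order_le0 (a b : R) : (forall t, 0 < t -> t * a <= t ^+ 2 * b) -> a <= 0.
Proof.
move=> h; rewrite leNgt; apply/negP => a0.
have c0 : 0 < `|b| + 1 by rewrite ltr_wpDl.
have t0 : 0 < a / (`|b| + 1) by rewrite divr_gt0.
have := h _ t0; rewrite expr2 -mulrA ler_pM2l// leNgt => /negP; apply.
rewrite mulrAC ltr_pdivrMr// ltr_pM2l//.
by rewrite (le_lt_trans (ler_norm b))// ltrDl.
Qed.

(** A zero of a nonnegative form is a minimum, hence a critical point. *)
Lemma form_ker p q (T : 'M[R]_(p, q) -> 'M[R]_(p, q)) V :
    linear T -> (forall U W, mxdot U (T W) = mxdot W (T U)) ->
    (forall W, 0 <= mxdot W (T W)) -> mxdot V (T V) = 0 ->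
  T V = 0.
Proof.
move=> Tlin Tsym Tpos TV0; apply/mxdot_eq0/le_anti/andP; split; last exact: mxdot_ge0.
have : mxdot (T V) (T V) *+ 2 <= 0.
  apply: (@first_order_le0 _ (mxdot (T V) (T (T V)))) => t t0.
  have := Tpos (- t *: T V + V).
  rewrite Tlin mxdotDl !mxdotDr !mxdotZl !mxdotZr TV0 addr0 -(Tsym V).
  by rewrite (Tsym V) => h; rewrite -subr_ge0; apply: le_trans h _; lra.
by rewrite pmulrn_lle0.
Qed.

Lemma mxdot_rank1 p (V : 'M[R]_p) (x : 'cV[R]_p) :
  mxdot V (x *m x^T) = mxdot x (V *m x).
Proof. by rewrite mxdot_mulmxr trmxK mxdotC. Qed.

Lemma mxdot_rank1_form p (x y : 'cV[R]_p) :
  mxdot y (x *m x^T *m y) = mxdot x y ^+ 2.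
Proof.
rewrite -mulmxA mxdot_mulmxl mxdotE !big_ord1 -expr2.
by rewrite /mxdot /mxtrace big_ord1.
Qed.

Lemma mulmx_mxdot p (x y z : 'cV[R]_p) : z *m (x^T *m y) = mxdot x y *: z.
Proof.
by rewrite [x^T *m y]mx11_scalar mul_mx_scalar /mxdot /mxtrace big_ord1.
Qed.

Lemma cauchy_schwarz p q (x y : 'M[R]_(p, q)) :
  mxdot x y ^+ 2 <= mxdot x x * mxdot y y.
Proof.
have [->|x0] := eqVneq x 0; first by rewrite !mxdot0l expr0n mul0r.
have := mxdot_ge0 (mxdot x x *: y - mxdot x y *: x).
rewrite mxdotBr !(mxdotC _ (_ *: _)) !mxdotZl !mxdotBr !mxdotZr (mxdotC y x).
set a := mxdot x x; set b := mxdot x y; set c := mxdot y y => h.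
have a0 : 0 < a by exact: mxdot_gt0.
rewrite -(ler_pM2l a0) -subr_ge0; apply: le_trans h _.
by rewrite expr2; lra.
Qed.

Lemma mxdot_col m n (a c : 'cV[R]_m) (b d : 'cV[R]_n) :
  mxdot (col_mx a b) (col_mx c d) = mxdot a c + mxdot b d.
Proof. by rewrite /mxdot tr_col_mx mul_row_col mxtraceD. Qed.

Definition psd p (M : 'M[R]_p) :=
  M^T = M /\ forall u : 'cV[R]_p, 0 <= mxdot u (M *m u).

Lemma mulmx_linear p q r (M : 'M[R]_(p, q)) : linear (@mulmx R p q r M).
Proof. by move=> a U V; rewrite mulmxDr scalemxAr. Qed.

Lemma mxdot_mulmx_sym p (M : 'M[R]_p) (u w : 'cV[R]_p) :
  M^T = M -> mxdot u (M *m w) = mxdot w (M *m u).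
Proof. by move=> MT; rewrite mxdot_mulmxl MT mxdotC. Qed.

Lemma psd_ker p (M : 'M[R]_p) (u : 'cV[R]_p) :
  psd M -> mxdot u (M *m u) = 0 -> M *m u = 0.
Proof.
move=> [MT Mpos]; apply: form_ker => //; first exact: mulmx_linear.
by move=> U W; exact: mxdot_mulmx_sym.
Qed.

Lemma posdefmxP p (M : 'M[R]_p) :
  posdefmx M <-> M^T = M /\ forall u : 'cV[R]_p, u != 0 -> 0 < mxdot u (M *m u).
Proof. by split=> -[MT h]; split=> // u /h; rewrite quad_mxdot. Qed.

Lemma posdef_psd p (M : 'M[R]_p) : posdefmx M -> psd M.
Proof.
move=> /posdefmxP[MT Mpos]; split=> // u.
by have [->|/Mpos/ltW//] := eqVneq u 0; rewrite mxdot0l.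
Qed.

Lemma posdef_neq0 p (M : 'M[R]_p) : (0 < p)%N -> posdefmx M -> M != 0.
Proof.
move=> p0 /posdefmxP[_ Mpos].
have e0 : (delta_mx (Ordinal p0) 0 : 'cV[R]_p) != 0.
  apply/eqP => /matrixP/(_ (Ordinal p0) 0); rewrite !mxE !eqxx => /eqP.
  by rewrite oner_eq0.
by apply: contraTneq (Mpos _ e0) => ->; rewrite mul0mx mxdot0r ltxx.
Qed.

(** The identity form has a largest eigenvalue relative to M; its inverse is the
    constant. *)
Lemma posdef_coercive p (M : 'M[R]_p) : posdefmx M ->
  exists2 c, 0 < c & forall u : 'cV[R]_p, c * mxdot u u <= mxdot u (M *m u).
Proof.
move=> /posdefmxP[MT Mpos].
have [[z z0]|/forallNP no] := pselect (exists z : 'cV[R]_p, z != 0); last first.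
  exists 1 => // u; have /negP := no u; rewrite negbK => /eqP ->.
  by rewrite !mxdot0l mulr0.
have [tau [V [V0 tauV] tauP]] :=
  @rayleigh R p 1 idfun (mulmx M) z z0 Mpos.
have t0 : 0 < tau.
  by rewrite -(pmulr_lgt0 _ (Mpos _ V0)) -tauV mxdot_gt0.
exists tau^-1; first by rewrite invr_gt0.
by move=> u; rewrite ler_pdivrMl//; exact: tauP.
Qed.

End Psd.

(** * The Perron-Frobenius theorem for self-adjoint completely positive maps *)

Section CpMap.
Variables (R : realType) (I : finType) (l : nat) (B : I -> 'M[R]_l).

(** The algebra generated by B is everything, phrased as an induction principle.
    The algebra is not assumed to contain the identity, so that the zero family
    does not generate the 1 x 1 matrices; the Perron eigenvalue of a generating
    family is then positive. *)
Definition generates := forall S : set 'M[R]_l,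
  (forall i, S (B i)) -> (forall a U V, S U -> S V -> S (a *: U + V)) ->
  (forall U V, S U -> S V -> S (U *m V)) -> forall W, S W.

Definition cpmap (V : 'M[R]_l) :=
  \sum_i (B i *m V *m (B i)^T + (B i)^T *m V *m B i).

Lemma cpmap_linear : linear cpmap.
Proof.
move=> a U V; rewrite /cpmap scaler_sumr -big_split; apply: eq_bigr => i _ /=.
rewrite scalerDr !mulmxDr !mulmxDl -!scalemxAr -!scalemxAl.
by rewrite addrACA.
Qed.

HB.instance Definition _ := GRing.isLinear.Build R _ _ _ cpmap cpmap_linear.

Lemma cpmap_sym U W : mxdot U (cpmap W) = mxdot W (cpmap U).
Proof.
rewrite /cpmap !mxdot_sumr; apply: eq_bigr => i _; rewrite !mxdotDr addrC.
by congr (_ + _); rewrite -mulmxA mxdot_mulmxl mxdot_mulmxr ?trmxK mxdotC.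
Qed.

Lemma cpmap_tr V : (cpmap V)^T = cpmap V^T.
Proof.
rewrite /cpmap raddf_sum; apply: eq_bigr => i _.
by rewrite raddfD /= !trmx_mul !trmxK !mulmxA.
Qed.

Lemma cpmap_form V (x y : 'cV[R]_l) : mxdot x (cpmap V *m y) =
  \sum_i (mxdot ((B i)^T *m x) (V *m ((B i)^T *m y)) +
          mxdot (B i *m x) (V *m (B i *m y))).
Proof.
rewrite /cpmap mulmx_suml mxdot_sumr; apply: eq_bigr => i _.
by rewrite mulmxDl mxdotDr; congr (_ + _); rewrite -!mulmxA mxdot_mulmxl ?trmxK.
Qed.

End CpMap.

Section PerronFrobenius.
Variables (R : realType) (J : finType) (l : nat) (B : J -> 'M[R]_l).
Hypothesis gen : generates B.
Local Notation Phi := (cpmap B).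

Lemma rank1_transport (x y : 'cV[R]_l) :
  x != 0 -> (mxdot x x)^-1 *: (y *m x^T) *m x = y.
Proof.
move=> x0; rewrite -scalemxAl -mulmxA mulmx_mxdot scalerA mulVf ?scale1r//.
by rewrite gt_eqF// mxdot_gt0.
Qed.

Lemma cpmap_psd P (x : 'cV[R]_l) : psd P -> 0 <= mxdot x (Phi P *m x).
Proof.
move=> [_ Ppos]; rewrite cpmap_form sumr_ge0// => i _.
by rewrite addr_ge0// Ppos.
Qed.

(** A sum of nonnegative terms is zero, so each of them is. This is how kernels
    of positive semidefinite matrices are seen to be invariant under all B_i. *)
Lemma cpmap_psd_eq0 P (x : 'cV[R]_l) : psd P -> mxdot x (Phi P *m x) <= 0 ->
  forall i, P *m ((B i)^T *m x) = 0 /\ P *m (B i *m x) = 0.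
Proof.
move=> Ppsd h i; have [_ Ppos] := Ppsd.
have : mxdot x (Phi P *m x) == 0 by rewrite eq_le h cpmap_psd.
rewrite cpmap_form psumr_eq0; last by move=> j _; rewrite addr_ge0// Ppos.
move=> /allP/(_ i (mem_index_enum _)) /=.
rewrite paddr_eq0 ?Ppos// => /andP[/eqP h1 /eqP h2].
by split; apply: psd_ker.
Qed.

Lemma psd_closed : closed [set P : 'M[R]_l | psd P].
Proof.
have -> : [set P : 'M[R]_l | psd P] =
   (\bigcap_(k in @setT ('I_l * 'I_l))
      (fun P : 'M[R]_l => P k.1 k.2 - P k.2 k.1) @^-1` [set x | x = 0])
   `&` (\bigcap_(u in @setT 'cV[R]_l)
      (fun P : 'M[R]_l => mxdot u (P *m u)) @^-1` [set x | 0 <= x]).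
  apply/seteqP; split=> [P [PT Ppos]|P [PT Ppos]].
    split=> [[i j] _ /=|u _ /=]; last exact: Ppos.
    by rewrite -{1}PT mxE subrr.
  split=> [|u]; last exact: (Ppos u I).
  by apply/matrixP => i j; rewrite mxE; apply/eqP; rewrite -subr_eq0 (PT (j, i) I).
apply: closedI; apply: closed_bigI => k _; (apply: closed_comp;
  last by [exact: closed_eq|exact: closed_ge]) => V _; apply: mxlinear_continuous => a U W.
  by rewrite !mxE; ring.
by rewrite mulmxDl -scalemxAl mxdotDr mxdotZr.
Qed.

Lemma psd_combination (P Q : 'M[R]_l) t : 0 <= t -> psd P -> psd Q -> psd (t *: Q + P).
Proof.
move=> t0 [PT Pp] [QT Qp]; split=> [|u]; first by rewrite linearP /= PT QT.
by rewrite mulmxDl -scalemxAl mxdotDr mxdotZr addr_ge0// mulr_ge0.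
Qed.

Lemma psd_rank1 (x : 'cV[R]_l) : psd (x *m x^T).
Proof.
by split=> [|u]; [rewrite trmx_mul trmxK|rewrite mxdot_rank1_form sqr_ge0].
Qed.

(** P maximises the form of Phi over the positive semidefinite matrices of norm
    one. The first variation along the cone gives Phi P <= lam P, which makes
    ker P invariant under every B_i and B_i^T, hence zero; then P is interior to
    the cone, the variation is two-sided, and the inequality is an equality. *)
Lemma perron_exists : (0 < l)%N ->
  exists P lam, [/\ posdefmx P, 0 < lam & Phi P = lam *: P].
Proof.
move=> l0.
have [P [P1 Ppsd] Pmax] : exists2 P, sphere P /\ psd P &
    forall Q, psd Q -> mxdot Q (Phi Q) <= mxdot P (Phi P) * mxdot Q Q.
  have [|||V _|P PA Pmax] :=
    @sphere_max R l l (@sphere R l l `&` [set P | psd P]) (fun V => mxdot V (Phi V)).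
  - by apply: closedI; [exact: closed_sphere|exact: psd_closed].
  - pose e : 'cV[R]_l := delta_mx (Ordinal l0) 0.
    exists (e *m e^T); split; last exact: psd_rank1.
    rewrite /sphere /= mxdot_rank1 mxdot_rank1_form /e /mxdot trmx_delta mul_delta_mx.
    by rewrite /mxtrace big_ord1 mxE eqxx expr1n.
  - by move=> V [].
  - exact: (@quad_continuous _ _ _ (cpmap B)).
  - exists P => // Q Qpsd.
    have [->|Q0] := eqVneq Q 0; first by rewrite !mxdot0l mulr0.
    have q0 := mxdot_gt0 Q0.
    pose a := (Num.sqrt (mxdot Q Q))^-1.
    have a2 : a * a = (mxdot Q Q)^-1.
      by rewrite /a -invfM -expr2 sqr_sqrtr// ltW.
    have := Pmax (a *: Q); rewrite linearZ /= !mxdotZr !mxdotZl mulrA a2.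
    rewrite mulrC ler_pdivrMr//; apply; split.
      by rewrite /sphere /= mxdotZr mxdotZl mulrA a2 mulVf// gt_eqF.
    rewrite -[a *: Q]addr0; apply: psd_combination => //.
      by rewrite invr_ge0 sqrtr_ge0.
    by split=> [|u]; rewrite ?trmx0// mul0mx mxdot0r.
set lam := mxdot P (Phi P) in Pmax.
have [PT Ppos] := Ppsd.
(* First variation at the maximiser, along rays inside the cone only. *)
have var Q : psd Q -> mxdot Q (Phi P) <= lam * mxdot Q P.
  move=> Qpsd; rewrite -subr_le0 -(@pmulrn_lle0 _ _ 2)//.
  apply: (@first_order_le0 _ _ (lam * mxdot Q Q - mxdot Q (Phi Q))) => t t0.
  have := Pmax _ (psd_combination (ltW t0) Ppsd Qpsd).
  rewrite linearP /= !mxdotDl !mxdotDr !mxdotZl !mxdotZr.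
  rewrite (cpmap_sym _ P Q) (mxdotC P Q) -/lam (_ : mxdot P P = 1)//.
  move=> h; lra.
have up (x : 'cV_l) : mxdot x (Phi P *m x) <= lam * mxdot x (P *m x).
  have := var _ (psd_rank1 x).
  by rewrite mxdotC mxdot_rank1 (mxdotC (x *m _)) mxdot_rank1.
have P0 : P != 0.
  by apply: contra_eqN P1 => /eqP ->; rewrite mxdot0l eq_sym oner_eq0.
have Pdef : posdefmx P.
  apply/posdefmxP; split=> // x x0; rewrite lt_neqAle Ppos andbT eq_sym.
  apply: contra_neqN P0 => /eqP /(psd_ker Ppsd) Px.
  have inv : forall W (u : 'cV_l), P *m u = 0 -> P *m (W *m u) = 0.
    apply: gen => [i u Pu|a U V hU hV u Pu|U V hU hV u Pu].
    - have [|_ //] := cpmap_psd_eq0 (x := u) Ppsd _ i.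
      by rewrite (le_trans (up u))// Pu mxdot0r mulr0.
    - by rewrite mulmxDl -scalemxAl mulmxDr -scalemxAr hU// hV// scaler0 addr0.
    - by rewrite -mulmxA hU// hV.
  apply/matrixP => i j; rewrite mxE.
  have := inv ((mxdot x x)^-1 *: (delta_mx j 0 *m x^T)) x Px.
  by rewrite rank1_transport// -colE => /matrixP/(_ i 0); rewrite !mxE.
have /posdefmxP[_ Pstrict] := Pdef.
have [c c0 Pc] := posdef_coercive Pdef.
(* By coercivity, subtracting a small multiple of x x^T from P stays in the
   cone: this is the variation in the opposite direction. *)
have down (x : 'cV_l) : lam * mxdot x (P *m x) <= mxdot x (Phi P *m x).
  pose t := c / (mxdot x x + 1).
  have x1 : 0 < mxdot x x + 1 by rewrite ltr_wpDl// mxdot_ge0.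
  have t0 : 0 < t by rewrite divr_gt0.
  have Qpsd : psd (- t *: (x *m x^T) + P).
    split=> [|u]; first by rewrite linearP /= trmx_mul trmxK PT.
    rewrite mulmxDl -scalemxAl mxdotDr mxdotZr mxdot_rank1_form mulNr addrC subr_ge0.
    apply: le_trans (Pc u); apply: le_trans (ler_wpM2l (ltW t0) (cauchy_schwarz x u)) _.
    rewrite mulrA ler_wpM2r ?mxdot_ge0// /t mulrAC ler_pdivrMr//.
    by rewrite ler_wpM2l ?(ltW c0)// lerDl.
  have := var _ Qpsd; rewrite !mxdotDl !mxdotZl -/lam (_ : mxdot P P = 1)//.
  rewrite !(mxdotC (x *m _)) !mxdot_rank1.
  move=> h; rewrite -(ler_pM2l t0); lra.
have eig : Phi P = lam *: P.
  apply/eqP; rewrite -subr_eq0; apply/eqP.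
  have zero (u : 'cV_l) : mxdot u ((Phi P - lam *: P) *m u) = 0.
    rewrite mulmxBl -scalemxAl mxdotBr mxdotZr.
    by apply/eqP; rewrite subr_eq0 eq_le up down.
  have NT : (Phi P - lam *: P)^T = Phi P - lam *: P.
    by rewrite raddfB /= cpmap_tr linearZ /= PT.
  apply/matrixP => i j; rewrite mxE.
  have psd0 : psd (Phi P - lam *: P) by split=> // u; rewrite zero.
  have := psd_ker psd0 (zero (delta_mx j 0)).
  by rewrite -colE => /matrixP/(_ i 0); rewrite !mxE.
exists P, lam; split=> //.
rewrite ltNge; apply/negP => lam0.
have B0 : forall (W : 'M[R]_l) (u : 'cV_l), W *m u = 0.
  apply: gen => [i u|a U V hU hV u|U V hU hV u].
  - have [|_ h] := cpmap_psd_eq0 (x := u) Ppsd _ i.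
      by rewrite (le_trans (up u))// mulr_le0_ge0.
    apply/eqP; rewrite -[_ == _]negbK; apply/negP => /Pstrict.
    by rewrite h mxdot0r ltxx.
  - by rewrite mulmxDl -scalemxAl hU hV scaler0 addr0.
  - by rewrite -mulmxA hV mulmx0.
have /matrixP/(_ (Ordinal l0) 0) := B0 1%:M (const_mx 1).
by rewrite mul1mx !mxE => /eqP; rewrite oner_eq0.
Qed.

(** Take the largest eigenvalue tau of the form x^T V y relative to
    x^T P x + y^T P y. The block matrix N = [tau P, -V; -V^T, tau P] is positive
    semidefinite and singular, and applying Phi to its blocks shows that its
    kernel is invariant under every diag(B_i, B_i), hence under every
    diag(W, W). A kernel vector (x, y) thus gives tau P W x = V W y for all W,
    and W ranging over matrices of rank one forces V to be a multiple of P. *)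
Lemma perron_unique P lam V mu : posdefmx P -> Phi P = lam *: P ->
  Phi V = mu *: V -> lam <= mu -> exists c, V = c *: P.
Proof.
move=> Pdef eigP eigV lam_mu.
have /posdefmxP[PT Pstrict] := Pdef.
have [->|V0] := eqVneq V 0; first by exists 0; rewrite scale0r.
have [b Vb0] : exists b : 'cV_l, V *m b != 0.
  apply/not_existsP => h; move/eqP: V0; apply; apply/matrixP => i j.
  have /negP := h (delta_mx j 0); rewrite negbK => /eqP.
  by rewrite -colE => /matrixP/(_ i 0); rewrite !mxE.
pose C := block_mx 0 V V^T 0; pose D := block_mx P 0 0 P.
have CE (x y : 'cV_l) :
    mxdot (col_mx x y) (C *m col_mx x y) = mxdot x (V *m y) *+ 2.
  rewrite mul_block_col !mul0mx add0r addr0 mxdot_col mulr2n; congr (_ + _).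
  by rewrite mxdot_mulmxl trmxK mxdotC.
have DE (x y : 'cV_l) : mxdot (col_mx x y) (D *m col_mx x y) =
    mxdot x (P *m x) + mxdot y (P *m y).
  by rewrite mul_block_col !mul0mx addr0 add0r mxdot_col.
have Dpos (z : 'cV_(l + l)) : z != 0 -> 0 < mxdot z (D *m z).
  rewrite -[z]vsubmxK DE col_mx_eq0 negb_and => /orP[h|h].
    by rewrite ltr_pwDl ?Pstrict//; case: (posdef_psd Pdef).
  by rewrite ltr_wpDl ?Pstrict//; case: (posdef_psd Pdef).
have w0 : col_mx (V *m b) b != 0 by rewrite col_mx_eq0 negb_and Vb0.
have [tau [z [z0 ztau] tauP]] :=
  @rayleigh R _ 1 (mulmx C) (mulmx D) _ w0 Dpos.
have tau0 : 0 < tau.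
  rewrite -(pmulr_lgt0 _ (Dpos _ w0)); apply: lt_le_trans (tauP _).
  by rewrite CE pmulrn_lgt0// mxdot_gt0.
pose N := tau *: D - C.
have NE z' : mxdot z' (N *m z') = tau * mxdot z' (D *m z') - mxdot z' (C *m z').
  by rewrite mulmxBl -scalemxAl mxdotBr mxdotZr.
have Npsd : psd N.
  split=> [|z']; last by rewrite NE subr_ge0 tauP.
  by rewrite raddfB /= linearZ /= !tr_block_mx !trmx0 trmxK PT.
have NF (x y : 'cV_l) : mxdot (col_mx x y) (N *m col_mx x y) =
    tau * (mxdot x (P *m x) + mxdot y (P *m y)) - mxdot x (V *m y) *+ 2.
  by rewrite NE CE DE.
have inv : forall W (x y : 'cV_l), N *m col_mx x y = 0 ->
    N *m col_mx (W *m x) (W *m y) = 0.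
  have colD a U W (x y : 'cV[R]_l) : col_mx ((a *: U + W) *m x) ((a *: U + W) *m y) =
      a *: col_mx (U *m x) (U *m y) + col_mx (W *m x) (W *m y).
    by rewrite !mulmxDl -!scalemxAl scale_col_mx add_col_mx.
  apply: gen => [i x y Nxy|a U W hU hW x y Nxy|U W hU hW x y Nxy]; last first.
  - by rewrite -!mulmxA hU// hW.
  - by rewrite colD mulmxDr -scalemxAr hU// hW// scaler0 addr0.
  have F0 : mxdot (col_mx x y) (N *m col_mx x y) = 0 by rewrite Nxy mxdot0r.
  pose F (u v : 'cV_l) := mxdot (col_mx u v) (N *m col_mx u v).
  have Fge (u v : 'cV_l) : 0 <= F u v by case: Npsd => _; exact.
  (* The form of N with its blocks replaced by their images under Phi. *)
  have sumF : \sum_j (F ((B j)^T *m x) ((B j)^T *m y) + F (B j *m x) (B j *m y)) =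
      (lam - mu) * (mxdot x (V *m y) *+ 2).
    transitivity (tau * (mxdot x (Phi P *m x) + mxdot y (Phi P *m y))
       - mxdot x (Phi V *m y) *+ 2).
      rewrite !cpmap_form -big_split mulr_sumr -sumrMnl -sumrB.
      by apply: eq_bigr => j _; rewrite /F !NF /=; ring.
    move: F0; rewrite NF eigP eigV -!scalemxAl !mxdotZr => /eqP.
    rewrite subr_eq0 => /eqP F0.
    by rewrite -mulrnAr mulrBl -F0; ring.
  have sumF0 : \sum_j (F ((B j)^T *m x) ((B j)^T *m y) + F (B j *m x) (B j *m y)) == 0.
    rewrite eq_le; apply/andP; split; last first.
      by apply: sumr_ge0 => j _; rewrite addr_ge0 ?Fge.
    rewrite sumF mulr_le0_ge0 ?subr_le0//.
    move: F0; rewrite NF => /eqP; rewrite subr_eq0 => /eqP <-.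
    by rewrite mulr_ge0 ?(ltW tau0)// addr_ge0//; case: (posdef_psd Pdef).
  move: sumF0; rewrite psumr_eq0; last by move=> j _; rewrite addr_ge0 ?Fge.
  move=> /allP/(_ i (mem_index_enum _)) /=.
  by rewrite paddr_eq0 ?Fge// => /andP[_ /eqP]; exact: psd_ker.
have Nz : N *m z = 0.
  by apply: psd_ker => //; rewrite NE ztau subrr.
move: z0 Nz {ztau}; rewrite -[z]vsubmxK; set x := usubmx z; set y := dsubmx z.
move=> xy0 Nxy.
(* The first block row of N (Wx, Wy) = 0. *)
have key W : tau *: (P *m (W *m x)) = V *m (W *m y).
  have /eqP := inv W x y Nxy.
  rewrite mulmxBl -scalemxAl !mul_block_col !mul0mx add0r !addr0 scale_col_mx.
  rewrite add0r opp_col_mx add_col_mx col_mx_eq0 => /andP[/eqP h _].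
  by apply/eqP; rewrite -subr_eq0 h.
have y0 : y != 0.
  apply: contraNneq xy0 => y0; rewrite col_mx_eq0 y0 eqxx andbT.
  have := key 1%:M; rewrite !mul1mx y0 mulmx0 => /eqP.
  rewrite scaler_eq0 gt_eqF//= => /eqP Px; apply: contraT => /Pstrict.
  by rewrite Px mxdot0r ltxx.
exists (tau * mxdot y x / mxdot y y).
apply/matrixP => i j; rewrite mxE.
have := key (delta_mx j 0 *m y^T).
rewrite -!(mulmxA (delta_mx j 0)) !mulmx_mxdot -!scalemxAr -!colE.
move=> /matrixP/(_ i 0); rewrite !mxE mulrA => h.
apply: (mulfI (x := mxdot y y)); first by rewrite gt_eqF// mxdot_gt0.
by rewrite -h; field; rewrite gt_eqF// mxdot_gt0.
Qed.

(** The largest eigenvalue of Phi on all matrices is at least lam, so its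
    eigenvectors are multiples of P by [perron_unique], and it equals lam. *)
Lemma perron_frobenius : (0 < l)%N ->
  exists P lam, [/\ posdefmx P, 0 < lam, Phi P = lam *: P,
    forall V, mxdot V (Phi V) <= lam * mxdot V V &
    forall V, mxdot V (Phi V) = lam * mxdot V V -> exists c, V = c *: P].
Proof.
move=> l0; have [P [lam [Pdef lam0 eigP]]] := perron_exists l0.
exists P, lam.
have P0 : P != 0 by exact: posdef_neq0.
have [mu [V [V0 Vmu] muP]] :=
  @rayleigh R l l (cpmap B) idfun P P0 (@mxdot_gt0 R l l).
have top W nu : (forall U, mxdot U (Phi U) <= nu * mxdot U U) ->
    mxdot W (Phi W) = nu * mxdot W W -> Phi W = nu *: W.
  move=> nuP Wnu; apply/eqP; rewrite eq_sym -subr_eq0; apply/eqP.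
  apply: (@form_ker _ _ _ (fun W => nu *: W - Phi W)).
  - move=> a U U'; rewrite cpmap_linear !scalerDr scalerN opprD addrACA.
    by rewrite !scalerA (mulrC nu a).
  - by move=> U U'; rewrite !mxdotBr !mxdotZr (mxdotC U) (cpmap_sym _ U).
  - by move=> U; rewrite mxdotBr mxdotZr subr_ge0 nuP.
  - by rewrite mxdotBr mxdotZr Wnu subrr.
have lam_mu : lam <= mu.
  by have := muP P; rewrite /= eigP mxdotZr ler_pM2r// mxdot_gt0.
have eigV := top V mu muP Vmu.
have mu_lam : mu = lam.
  have [c Vc] := perron_unique Pdef eigP eigV lam_mu.
  have c0 : c != 0 by apply: contra_neq V0 => c0; rewrite Vc c0 scale0r.
  have : (mu - lam) *: V = 0.
    by rewrite scalerBl -eigV Vc linearZ /= eigP !scalerA (mulrC lam) subrr.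
  by move=> /eqP; rewrite scaler_eq0 (negPf V0) orbF subr_eq0 => /eqP.
rewrite mu_lam in muP.
split=> // W /top eigW.
exact: (perron_unique Pdef eigP (eigW muP)).
Qed.

End PerronFrobenius.

(** * Evaluation of matrix polynomials on vectors in matrix form *)

Section Evaluation.
Variables (R : realType) (g : nat).
Local Notation tuple := (mxtuple R g).

(** The identification of R^{l x n} with R^{ln} that matches the Kronecker
    product. *)
Definition colvec l n (V : 'M[R]_(l, n)) : 'cV[R]_(l * n) :=
  \col_k V (mxtens_unindex k).1 (mxtens_unindex k).2.

Definition uncolvec l n (v : 'cV[R]_(l * n)) : 'M[R]_(l, n) :=
  \matrix_(i, j) v (mxtens_index (i, j)) 0.

Lemma uncolvecK l n : cancel (@uncolvec l n) (@colvec l n).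
Proof.
move=> v; apply/matrixP => k j; rewrite !mxE (ord1 j).
by rewrite -surjective_pairing mxtens_unindexK.
Qed.

Lemma colvecK l n : cancel (@colvec l n) (@uncolvec l n).
Proof. by move=> V; apply/matrixP => i j; rewrite !mxE mxtens_indexK. Qed.

Lemma colvec_linear l n : linear (@colvec l n).
Proof. by move=> a U V; apply/matrixP => i j; rewrite !mxE. Qed.

HB.instance Definition _ l n :=
  GRing.isLinear.Build R _ _ _ (@colvec l n) (@colvec_linear l n).

Lemma mxtens_sum (l n : nat) (F : 'I_l -> 'I_n -> R) :
  \sum_(k < l * n) F (mxtens_unindex k).1 (mxtens_unindex k).2 =
  \sum_i \sum_j F i j.
Proof.
rewrite pair_big (reindex (@mxtens_unindex l n))//=.
by exists (@mxtens_index l n) => k _; rewrite ?mxtens_indexK ?mxtens_unindexK.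
Qed.

Lemma mxdot_colvec l n (V W : 'M[R]_(l, n)) :
  mxdot (colvec V) (colvec W) = mxdot V W.
Proof.
rewrite !mxdotE -[RHS]mxtens_sum; apply: eq_bigr => k _.
by rewrite big_ord1 !mxE.
Qed.

Lemma tens_colvec a l n m (A : 'M[R]_(a, l)) (X : 'M[R]_(m, n)) (V : 'M[R]_(l, n)) :
  (A *t X) *m colvec V = colvec (A *m V *m X^T).
Proof.
apply/matrixP => k j; rewrite !mxE.
transitivity (\sum_i \sum_j A (mxtens_unindex k).1 i * X (mxtens_unindex k).2 j * V i j).
  by rewrite -mxtens_sum; apply: eq_bigr => i _; rewrite !mxE.
rewrite exchange_big; apply: eq_bigr => i _ /=; rewrite !mxE mulr_suml.
by apply: eq_bigr => i' _; rewrite mulrAC.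
Qed.

(** Evaluations of different polynomials can be compared once they are sums over
    a common support. *)
Lemma nceval_supp a b (p : ncpoly R g a b) (S : {fset word g}) n (X : tuple n) :
  (msupp p `<=` S)%fset -> nceval p X = \sum_(w <- S) mcoeff w p *t word_eval X w.
Proof.
move=> pS; rewrite /nceval; apply: big_fset_incl => // w _ /mcoeff_outdom ->.
by rewrite tens0mx.
Qed.

Lemma tensmxDl a b c d (A A' : 'M[R]_(a, b)) (B : 'M[R]_(c, d)) :
  (A + A') *t B = A *t B + A' *t B.
Proof. by apply/matrixP => i j; rewrite !mxE mulrDl. Qed.

Lemma ncevalD a b (p q : ncpoly R g a b) n (X : tuple n) :
  nceval (p + q) X = nceval p X + nceval q X.
Proof.
rewrite (@nceval_supp _ _ (p + q) (msupp p `|` msupp q)%fset) ?msuppD_le//.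
rewrite (@nceval_supp _ _ p (msupp p `|` msupp q)%fset) ?fsubsetUl//.
rewrite (@nceval_supp _ _ q (msupp p `|` msupp q)%fset) ?fsubsetUr//.
by rewrite -big_split; apply: eq_bigr => w _; rewrite mcoeffD tensmxDl.
Qed.

Lemma nceval0 a b n (X : tuple n) : nceval (0 : ncpoly R g a b) X = 0.
Proof. by apply: (addrI (nceval 0 X)); rewrite -ncevalD !addr0. Qed.

Lemma nceval_monomial a b (A : 'M[R]_(a, b)) s n (X : tuple n) :
  nceval (monomial A s) X = A *t word_eval X (FMonom s).
Proof.
rewrite (@nceval_supp _ _ _ [fset (FMonom s : word g)]%fset) ?msuppU_le//.
by rewrite big_seq_fset1 mcoeffUU.
Qed.

Lemma word_eval_nil n (X : tuple n) : word_eval X (FMonom [::]) = 1%:M.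
Proof. by rewrite /word_eval /= big_nil. Qed.

Lemma word_eval_letter n (X : tuple n) c :
  word_eval X (FMonom [:: c]) = letter_eval X c.
Proof. by rewrite /word_eval /= big_cons big_nil mulmx1. Qed.

Definition affine_ncpoly a b (B : 'M[R]_(a, b)) (C C' : 'I_g -> 'M[R]_(a, b)) :
    ncpoly R g a b :=
  monomial B [::] +
  \sum_(i < g) (monomial (C i) [:: inl i] + monomial (C' i) [:: inr i]).

Lemma nceval_affine a b (B : 'M[R]_(a, b)) C C' n (X : tuple n) :
  nceval (affine_ncpoly B C C') X =
  B *t 1%:M + \sum_i (C i *t X 0 i + C' i *t (X 0 i)^T).
Proof.
rewrite ncevalD nceval_monomial word_eval_nil; congr (_ + _).
rewrite (big_morph _ (fun p q => ncevalD p q X) (nceval0 _ _ X)).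
apply: eq_bigr => i _; rewrite ncevalD; congr (_ + _).
  by rewrite nceval_monomial word_eval_letter.
by rewrite nceval_monomial word_eval_letter.
Qed.

(** The pencil acting on vectors in matrix form, see [monic_pencil_colvec]. *)
Definition pencil_map l (A : tuple l) n (X : tuple n) (V : 'M[R]_(l, n)) :=
  V + \sum_i (A 0 i *m V *m (X 0 i)^T + (A 0 i)^T *m V *m X 0 i).

Lemma monic_pencil_colvec l (A : tuple l) n (X : tuple n) V :
  nceval (monic_pencil A) X *m colvec V = colvec (pencil_map A X V).
Proof.
rewrite [monic_pencil A](_ : _ = affine_ncpoly 1%:M (A 0) (fun i => (A 0 i)^T)) //.
rewrite nceval_affine mulmxDl tens_colvec mul1mx trmx1 mulmx1 raddfD; congr (_ + _).
rewrite mulmx_suml raddf_sum; apply: eq_bigr => i _.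
by rewrite mulmxDl raddfD /= !tens_colvec trmxK.
Qed.

Lemma monic_pencil_sym l (A : tuple l) n (X : tuple n) :
  (nceval (monic_pencil A) X)^T = nceval (monic_pencil A) X.
Proof.
rewrite [monic_pencil A](_ : _ = affine_ncpoly 1%:M (A 0) (fun i => (A 0 i)^T)) //.
rewrite nceval_affine raddfD /= trmx_tens !trmx1; congr (_ + _).
rewrite raddf_sum; apply: eq_bigr => i _.
by rewrite raddfD /= !trmx_tens !trmxK addrC.
Qed.

Definition tuple_dsum n m (X : tuple n) (Y : tuple m) : tuple (n + m) :=
  \row_i block_mx (X 0 i) 0 0 (Y 0 i).

Lemma word_eval_tuple_dsum n m (X : tuple n) (Y : tuple m) w :
  word_eval (tuple_dsum X Y) w = block_mx (word_eval X w) 0 0 (word_eval Y w).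
Proof.
rewrite /word_eval; elim: (fmonom_val w) => [|c s IH].
  by rewrite !big_nil [1%:M]scalar_mx_block.
rewrite !big_cons IH; have -> : letter_eval (tuple_dsum X Y) c =
    block_mx (letter_eval X c) 0 0 (letter_eval Y c).
  by case: c => i /=; rewrite mxE // tr_block_mx !trmx0.
by rewrite mulmx_block !mulmx0 !mul0mx !addr0 !add0r.
Qed.

Lemma nceval_colvec a b (p : ncpoly R g a b) n (X : tuple n) V :
  nceval p X *m colvec V =
  colvec (\sum_(w <- msupp p) mcoeff w p *m V *m (word_eval X w)^T).
Proof.
rewrite /nceval mulmx_suml raddf_sum; apply: eq_bigr => w _.
by rewrite tens_colvec.
Qed.

(** Evaluation respects direct sums, so that an auxiliary summand may be added
    to a point and dropped again in the conclusion. *)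
Lemma nceval_tuple_dsum_eq0 a b (p : ncpoly R g a b) n m (X : tuple n) (Y : tuple m) V W :
  nceval p (tuple_dsum X Y) *m colvec (row_mx V W) = 0 -> nceval p X *m colvec V = 0.
Proof.
rewrite !nceval_colvec => /(congr1 (@uncolvec _ _)); rewrite colvecK => h.
rewrite [X in colvec X](_ : _ = 0) ?raddf0//.
have -> : \sum_(w <- msupp p) mcoeff w p *m V *m (word_eval X w)^T =
    lsubmx (\sum_(w <- msupp p) mcoeff w p *m row_mx V W *m (word_eval (tuple_dsum X Y) w)^T).
  rewrite raddf_sum; apply: eq_bigr => w _ /=.
  rewrite word_eval_tuple_dsum tr_block_mx !trmx0 mul_mx_row mul_row_block.
  by rewrite !mulmx0 !addr0 row_mxKl.
by rewrite h; apply/matrixP => i j; rewrite !mxE.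
Qed.

(** The rows of L, as polynomials in R^{1 x l}<x,x^*>, vanish on the boundary. *)
Lemma zero_closure_sub_variety l (A : tuple l) n :
  @zero_closure R g l (detailed_boundary (monic_pencil A)) n `<=`
  @pencil_variety R g l (monic_pencil A) n.
Proof.
move=> [X v] /= h; rewrite /pencil_variety /= -(uncolvecK v).
rewrite monic_pencil_colvec.
have rowE k m (Y : tuple m) W :
    nceval (affine_ncpoly (row k 1%:M) (fun i => row k (A 0 i))
            (fun i => row k (A 0 i)^T)) Y *m colvec W = colvec (row k (pencil_map A Y W)).
  rewrite nceval_affine mulmxDl tens_colvec trmx1 mulmx1 -row_mul mul1mx.
  rewrite /pencil_map 2!raddfD /=; congr (_ + _).
  rewrite mulmx_suml !raddf_sum; apply: eq_bigr => i _.
  by rewrite mulmxDl !raddfD /= !tens_colvec trmxK -!row_mul.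
have row0 k : row k (pencil_map A X (uncolvec v)) = 0.
  apply: (can_inj (@colvecK _ _)); rewrite -rowE uncolvecK raddf0.
  apply: h => m [Y w] [_ /=]; rewrite -(uncolvecK w) monic_pencil_colvec => Lw.
  rewrite rowE; move/(congr1 (@uncolvec _ _)): Lw; rewrite colvecK => ->.
  by apply/matrixP => i j; rewrite !mxE.
rewrite [pencil_map _ _ _](_ : _ = 0) ?raddf0//; apply/row_matrixP => k.
by rewrite row0 raddf0.
Qed.

End Evaluation.

(** * Polynomial paths of matrices *)

Section PolyFun.
Variable R : realType.

Definition polymx a b (M : R -> 'M[R]_(a, b)) :=
  forall i j, exists q : {poly R}, forall t, M t i j = q.[t].

Lemma polymx_cst a b (M : 'M[R]_(a, b)) : polymx (fun=> M).
Proof. by move=> i j; exists (M i j)%:P => t; rewrite hornerC. Qed.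

Lemma polymxD a b (M N : R -> 'M[R]_(a, b)) :
  polymx M -> polymx N -> polymx (fun t => M t + N t).
Proof.
move=> pM pN i j; have [q qM] := pM i j; have [r rN] := pN i j.
by exists (q + r) => t; rewrite mxE qM rN hornerD.
Qed.

Lemma polymx_sum (I : Type) (s : seq I) a b (M : I -> R -> 'M[R]_(a, b)) :
  (forall k, polymx (M k)) -> polymx (fun t => \sum_(k <- s) M k t).
Proof.
move=> pM i j; have {pM} /choice[q qM] := fun k => pM k i j.
exists (\sum_(k <- s) q k) => t.
by rewrite summxE horner_sum; apply: eq_bigr => k _; exact: qM.
Qed.

Lemma polymx_mul a b c (M : R -> 'M[R]_(a, b)) (N : R -> 'M[R]_(b, c)) :
  polymx M -> polymx N -> polymx (fun t => M t *m N t).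
Proof.
move=> pM pN i j.
have /choice[q qM] := fun k => pM i k; have /choice[r rN] := fun k => pN k j.
exists (\sum_k q k * r k) => t; rewrite mxE horner_sum.
by apply: eq_bigr => k _; rewrite qM rN hornerM.
Qed.

Lemma polymx_scale a b (f : R -> R) (q : {poly R}) (M : 'M[R]_(a, b)) :
  (forall t, f t = q.[t]) -> polymx (fun t => f t *: M).
Proof.
by move=> fq i j; exists (q * (M i j)%:P) => t; rewrite mxE fq hornerM hornerC.
Qed.

Lemma polymx_tr a b (M : R -> 'M[R]_(a, b)) : polymx M -> polymx (fun t => (M t)^T).
Proof. by move=> pM i j; have [q qM] := pM j i; exists q => t; rewrite mxE. Qed.

Lemma polymx_tens a b c d (A : 'M[R]_(a, b)) (M : R -> 'M[R]_(c, d)) :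
  polymx M -> polymx (fun t => A *t M t).
Proof.
move=> pM i j; have [q qM] := pM (mxtens_unindex i).2 (mxtens_unindex j).2.
by exists ((A (mxtens_unindex i).1 (mxtens_unindex j).1)%:P * q) => t;
  rewrite mxE hornerM hornerC qM.
Qed.

Lemma polymx_row a b c (M : R -> 'M[R]_(a, b)) (N : R -> 'M[R]_(a, c)) :
  polymx M -> polymx N -> polymx (fun t => row_mx (M t) (N t)).
Proof.
move=> pM pN i j; case: (split_ordP j) => k ->.
  by have [q qM] := pM i k; exists q => t; rewrite row_mxEl.
by have [q qN] := pN i k; exists q => t; rewrite row_mxEr.
Qed.

Lemma polymx_block a b c d (M : R -> 'M[R]_(a, b)) (N : R -> 'M[R]_(a, c))
    (M' : R -> 'M[R]_(d, b)) (N' : R -> 'M[R]_(d, c)) :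
  polymx M -> polymx N -> polymx M' -> polymx N' ->
  polymx (fun t => block_mx (M t) (N t) (M' t) (N' t)).
Proof.
move=> pM pN pM' pN' i j.
have [q qM] := polymx_tr (polymx_row (polymx_tr (polymx_row pM pN))
                                     (polymx_tr (polymx_row pM' pN'))) i j.
by exists q => t; rewrite -qM tr_row_mx !trmxK.
Qed.

Lemma polymx_colvec l n (V : R -> 'M[R]_(l, n)) :
  polymx V -> polymx (fun t => colvec (V t)).
Proof.
move=> pV i j; have [q qV] := pV (mxtens_unindex i).1 (mxtens_unindex i).2.
by exists q => t; rewrite mxE.
Qed.

Lemma polymx_word_eval g n (X : R -> mxtuple R g n) w :
  (forall i, polymx (fun t => X t 0 i)) -> polymx (fun t => word_eval (X t) w).
Proof.
rewrite /word_eval => pX; elim: (fmonom_val w) => [|c s IH].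
  by move=> i j; exists (1%:M i j)%:P => t; rewrite big_nil hornerC.
have pc : polymx (fun t => letter_eval (X t) c).
  by case: c => i /=; [exact: pX|exact/polymx_tr/pX].
move=> i j; have [q qM] := polymx_mul pc IH i j.
by exists q => t; rewrite big_cons qM.
Qed.

Lemma polymx_nceval g a b (p : ncpoly R g a b) n (X : R -> mxtuple R g n) :
  (forall i, polymx (fun t => X t 0 i)) -> polymx (fun t => nceval p (X t)).
Proof.
by move=> pX; apply: polymx_sum => w; exact/polymx_tens/polymx_word_eval.
Qed.

(** The points e / (k + 2) are infinitely many zeros. *)
Lemma polymx_eq0 a b (M : R -> 'M[R]_(a, b)) e : polymx M -> 0 < e ->
  (forall t, `|t| < e -> M t = 0) -> forall t, M t = 0.
Proof.
move=> pM e0 M0 t; apply/matrixP => i j; rewrite mxE.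
have [q qM] := pM i j.
suff q0 : q = 0 by rewrite qM q0 horner0.
pose rs := [seq e / k.+2%:R | k <- iota 0 (size q)].
apply: (@roots_geq_poly_eq0 _ _ rs); last by rewrite size_map size_iota.
  apply/allP => _ /mapP[k _ ->]; rewrite /root -qM M0 ?mxE//.
  rewrite ger0_norm ?divr_ge0 ?(ltW e0)// ltr_pdivrMr// -{1}[e]mulr1 ltr_pM2l//.
  by rewrite ltr1n.
rewrite map_inj_in_uniq ?iota_uniq// => k k' _ _ /(mulfI (lt0r_neq0 e0)).
by move=> /invr_inj/eqP; rewrite eqr_nat => /eqP[].
Qed.

Lemma form_bound m (E : 'M[R]_m) (y : 'cV[R]_m) :
  `|mxdot y (E *m y)| <= (\sum_i \sum_j `|E i j|) * mxdot y y.
Proof.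
have -> : mxdot y (E *m y) = \sum_i \sum_j y i 0 * (E i j * y j 0).
  by rewrite mxdotE; apply: eq_bigr => i _; rewrite big_ord1 mxE mulr_sumr.
rewrite mulr_suml; apply: le_trans (ler_norm_sum _ _ _) _; apply: ler_sum => i _.
rewrite mulr_suml; apply: le_trans (ler_norm_sum _ _ _) _; apply: ler_sum => j _.
rewrite mulrCA normrM ler_wpM2l// normrM.
have := mxdot_coord y i 0; have := mxdot_coord y j 0.
have := sqr_ge0 (`|y i 0| - `|y j 0|).
by rewrite sqrrB; lra.
Qed.

(** On the hyperplane orthogonal to v(0) the form of M(0) is coercive, so that
    of M(t) is nonnegative there for small t. Every vector is the sum of an
    element of this hyperplane and a multiple of v(t), which M(t) annihilates. *)
Lemma simple_kernel_stable m (M : R -> 'M[R]_m) (v : R -> 'cV[R]_m) :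
    polymx M -> (forall t, (M t)^T = M t) -> (forall t, M t *m v t = 0) ->
    (forall t, 0 < mxdot (v 0) (v t)) ->
    (forall u : 'cV[R]_m, 0 <= mxdot u (M 0 *m u)) ->
    (forall u : 'cV[R]_m, mxdot u (M 0 *m u) = 0 -> exists c, u = c *: v 0) ->
  exists2 e, 0 < e & forall t, `|t| < e -> psd (M t).
Proof.
move=> pM MT Mv vv M0 M0ker.
have Npos : posdefmx (M 0 + v 0 *m (v 0)^T).
  apply/posdefmxP; split=> [|u u0]; first by rewrite raddfD /= MT trmx_mul trmxK.
  rewrite mulmxDl mxdotDr mxdot_rank1_form lt_neqAle addr_ge0 ?M0 ?sqr_ge0// andbT.
  rewrite eq_sym paddr_eq0 ?M0 ?sqr_ge0// sqrf_eq0; apply/negP => /andP[/eqP /M0ker[c uc]].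
  rewrite uc mxdotZr mulf_eq0 (gt_eqF (vv 0)) orbF => /eqP c0.
  by move: u0; rewrite uc c0 scale0r eqxx.
have [c c0 Nc] := posdef_coercive Npos.
pose delta t := \sum_i \sum_j `|(M t - M 0) i j|.
have dcont : continuous delta.
  apply: sum_continuous => i; apply: sum_continuous => j.
  have [q qM] := pM i j.
  have -> : (fun t => `|(M t - M 0) i j|) = (fun t => `|(q - (M 0 i j)%:P).[t]|).
    by apply/funext => t; rewrite !mxE (qM t) hornerD hornerN hornerC.
  by move=> t; apply: cvg_norm; exact: continuous_horner.
have d0 : delta 0 = 0.
  by rewrite /delta big1// => i _; rewrite big1// => j _; rewrite subrr mxE normr0.
have : \forall t \near (0 : R), delta t < c.
  by apply: (cvgr_lt (delta 0) (dcont 0)); rewrite d0.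
move=> /nbhs_ballP[e /= e0 ec]; exists e => // t te; split=> // u.
have dt : delta t < c by apply: ec; rewrite /ball /= sub0r normrN.
pose y := u - (mxdot (v 0) u / mxdot (v 0) (v t)) *: v t.
have vy : mxdot (v 0) y = 0.
  by rewrite mxdotBr mxdotZr mulfVK ?subrr// gt_eqF// vv.
have My : M t *m u = M t *m y.
  by rewrite mulmxBr -scalemxAr Mv scaler0 subr0.
have -> : mxdot u (M t *m u) = mxdot y (M t *m y).
  by rewrite My (mxdot_mulmx_sym u y (MT t)) My.
clearbody y.
have := Nc y; rewrite mulmxDl mxdotDr mxdot_rank1_form vy expr0n addr0.
have := form_bound (M t - M 0) y; rewrite mulmxBl mxdotBr -/(delta t).
rewrite ler_norml => /andP[h _] h'.
have : delta t * mxdot y y <= c * mxdot y y by rewrite ler_wpM2r ?mxdot_ge0// ltW.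
lra.
Qed.

End PolyFun.

(** * Boundary points of the domain *)

Section Boundary.
Variables (R : realType) (g l : nat) (A : mxtuple R g l).

Definition scale_tuple n (s : R) (X : mxtuple R g n) : mxtuple R g n :=
  \row_i (s *: X 0 i).

Lemma scale_tuple_continuous n (X : mxtuple R g n) :
  continuous (fun s => scale_tuple s X).
Proof.
move=> s; apply: mx_cvg => i j; apply: mx_cvg => a b.
rewrite [X in X @ _](_ : _ = fun s => s * X 0 j a b); last first.
  by apply/funext => r; rewrite !mxE.
rewrite !mxE; apply: cvgM; [exact: cvg_id|exact: cvg_cst].
Qed.

Lemma pencil_map_scale n s (X : mxtuple R g n) V :
  pencil_map A (scale_tuple s X) V = (1 - s) *: V + s *: pencil_map A X V.
Proof.
rewrite /pencil_map scalerDr addrA -scalerDl subrK scale1r; congr (_ + _).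
rewrite scaler_sumr; apply: eq_bigr => i _.
by rewrite !mxE linearZ /= -!scalemxAr scalerDr.
Qed.

(** L(sX) = (1 - s) 1 + s L(X) is positive definite for 0 <= s < 1, so the
    segment from 0 towards X stays in the component of 0 and ends at X. *)
Lemma psd_boundary n (X : mxtuple R g n) (v : 'cV[R]_(l * n)) :
  psd (nceval (monic_pencil A) X) -> nceval (monic_pencil A) X *m v = 0 ->
  @detailed_boundary R g l (monic_pencil A) n (X, v).
Proof.
move=> [_ Lpos] Lv; split=> //=.
have inside s : 0 <= s < 1 -> posdefmx (nceval (monic_pencil A) (scale_tuple s X)).
  move=> /andP[s0 s1]; apply/posdefmxP; split=> [|u u0]; first exact: monic_pencil_sym.
  have {Lpos} := Lpos u; move: u0; rewrite -(uncolvecK u); set U := uncolvec u => u0.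
  rewrite !monic_pencil_colvec pencil_map_scale linearP /= linearZ /= mxdotDr !mxdotZr => Lu.
  by rewrite ltr_pwDl ?mulr_ge0// mulr_gt0 ?subr_gt0// mxdot_gt0.
have seg s : 0 <= s < 1 -> posdomain (monic_pencil A) (scale_tuple s X).
  move=> /andP[s0 s1].
  apply: (@connected_component_max _ _ ((fun s => scale_tuple s X) @` `[0, s])).
  - exists 0; first by rewrite /= in_itv /= lexx.
    by apply/matrixP => i j; rewrite !mxE scale0r.
  - move=> _ [r /= r0s <-]; apply: inside; move: r0s; rewrite in_itv /= => /andP[-> rs] /=.
    exact: le_lt_trans rs s1.
  - apply: connected_continuous_connected; first exact: segment_connected.
    by apply: continuous_subspaceT; exact: scale_tuple_continuous.
  - by exists s => //; rewrite /= in_itv /= s0 lexx.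
move=> B nB.
have X1 : scale_tuple 1 X = X by apply/matrixP => i j; rewrite mxE scale1r (ord1 i).
have /nbhs_ballP[e /= e0 eB] : nbhs (1 : R) ((fun s => scale_tuple s X) @^-1` B).
  by apply: scale_tuple_continuous; rewrite X1.
pose s := Num.max 0 (1 - e / 2).
have s1 : s < 1 by rewrite /s gt_max ltr01 ltrBlDr ltrDl divr_gt0.
have s0 : 0 <= s by rewrite /s le_max lexx.
exists (scale_tuple s X); split; first by apply: seg; rewrite s0.
apply: eB; rewrite /ball /= ger0_norm ?subr_ge0 ?(ltW s1)//.
have : 1 - e / 2 <= s by rewrite /s le_max lexx orbT.
lra.
Qed.

End Boundary.

(** * Paths in the variety of the pencil *)

Section Perturbation.
Variables (R : realType) (g l : nat) (A : mxtuple R g l).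

Lemma mxdot_tr p q (V W : 'M[R]_(p, q)) : mxdot V^T W^T = mxdot V W.
Proof. by rewrite /mxdot trmxK -mxtrace_tr trmx_mul trmxK mxtrace_mulC. Qed.

Lemma sum_row_mx (I : finType) p q r (F : I -> 'M[R]_(p, q)) (G : I -> 'M[R]_(p, r)) :
  \sum_i row_mx (F i) (G i) = row_mx (\sum_i F i) (\sum_i G i).
Proof.
apply/matrixP => i j; rewrite summxE; case: (split_ordP j) => k ->.
  by rewrite row_mxEl summxE; apply: eq_bigr => h _; rewrite row_mxEl.
by rewrite row_mxEr summxE; apply: eq_bigr => h _; rewrite row_mxEr.
Qed.

Lemma unitmx_ker m (M : 'M[R]_m) :
  (forall u : 'cV[R]_m, M *m u = 0 -> u = 0) -> M \in unitmx.
Proof.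
move=> Mker; rewrite -unitmx_tr -row_free_unit -kermx_eq0.
apply/eqP/row_matrixP => i; rewrite row0; apply: trmx_inj; rewrite trmx0.
apply: Mker; apply: trmx_inj; rewrite trmx_mul trmxK trmx0.
by rewrite -row_mul mulmx_ker row0.
Qed.

Lemma surj_of_posdef_form p q (T : {linear 'M[R]_(p, q) -> 'M[R]_(p, q)}) :
  (forall W, mxdot W (T W) = 0 -> W = 0) -> forall M, exists W, T W = M.
Proof.
move=> Tker M.
have : lin_mx T \in unitmx.
  rewrite -row_free_unit -kermx_eq0; apply/eqP/row_matrixP => i; rewrite row0.
  set u := row i _; have : u *m lin_mx T = 0 by rewrite /u -row_mul mulmx_ker row0.
  rewrite -[u]vec_mxK mul_vec_lin => /eqP; rewrite mxvec_eq0 => /eqP Tu.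
  by rewrite (Tker (vec_mx u)) ?linear0// Tu mxdot0r.
move=> uT; exists (vec_mx (mxvec M *m invmx (lin_mx T))).
by apply: (can_inj mxvecK); rewrite -mul_vec_lin vec_mxK mulmxKV.
Qed.

Lemma posdef_unit m (P : 'M[R]_m) : posdefmx P -> P \in unitmx.
Proof.
move=> /posdefmxP[_ Pp]; apply: unitmx_ker => u Pu; apply/eqP; rewrite -[_ == _]negbK.
by apply/negP => /Pp; rewrite Pu mxdot0r ltxx.
Qed.

(** Compose the map D |-> sum_i (A_i P D_i^T + A_i^T P D_i) with its adjoint
    W |-> (W^T A_i P + P A_i W)_i. The composite is positive definite when the
    adjoint is injective, and Z = P^{-1} W^T turns the equations of its kernel
    into Z A_i + A_i Z^T = 0. *)
Lemma perturbation_surj (P : 'M[R]_l) : posdefmx P ->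
    (forall Z, (forall i, Z *m A 0 i + A 0 i *m Z^T = 0) -> Z = 0) ->
  forall M, exists D : 'I_g -> 'M[R]_l,
    \sum_i (A 0 i *m P *m (D i)^T + (A 0 i)^T *m P *m D i) = M.
Proof.
move=> Pdef skew M.
have uP := posdef_unit Pdef; have [PT _] := Pdef.
pose D W i := W^T *m A 0 i *m P + P *m A 0 i *m W.
pose T W := \sum_i (A 0 i *m P *m (D W i)^T + (A 0 i)^T *m P *m D W i).
have Dlin a U W i : D (a *: U + W) i = a *: D U i + D W i.
  by rewrite /D linearP /= !mulmxDl !mulmxDr -!scalemxAl -!scalemxAr scalerDr addrACA.
have Tlin : linear T.
  move=> a U W; rewrite /T scaler_sumr -big_split; apply: eq_bigr => i _ /=.
  rewrite Dlin; move: (D U i) (D W i) => DU DW.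
  by rewrite linearP /= !mulmxDr -!scalemxAr scalerDr addrACA.
pose b := GRing.isLinear.Build R _ _ _ T Tlin.
pose TL : {linear 'M[R]_l -> 'M[R]_l} := HB.pack T b.
have TE W : mxdot W (T W) = \sum_i mxdot (D W i) (D W i).
  rewrite mxdot_sumr; apply: eq_bigr => i _; rewrite mxdotDr [in RHS]mxdotDl.
  rewrite -!mulmxA; congr (_ + _).
    by rewrite !mxdot_mulmxl PT -[RHS]mxdot_tr !trmx_mul trmxK PT !mulmxA.
  by rewrite !mxdot_mulmxl trmxK PT !mulmxA.
have [|W TW] := @surj_of_posdef_form l l TL _ M; last by exists (D W).
move=> W /= TW0.
have DW i : D W i = 0.
  apply: mxdot_eq0; move/eqP: TW0.
  rewrite TE psumr_eq0; last by move=> j _; exact: mxdot_ge0.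
  by move=> /allP/(_ i (mem_index_enum _))/eqP.
have Z0 : invmx P *m W^T = 0.
  apply: skew => i; rewrite trmx_mul trmxK trmx_inv PT mulmxA.
  have : invmx P *m D W i *m invmx P = 0 by rewrite DW mulmx0 mul0mx.
  by rewrite /D mulmxDr mulmxDl !mulmxA mulmxK// mulVmx// mul1mx.
have : P *m (invmx P *m W^T) = 0 by rewrite Z0 mulmx0.
by rewrite mulKVmx// => /(congr1 trmx); rewrite trmxK trmx0.
Qed.

(** Block upper triangular tuples contain the direct sums and the corrections of
    them that are used below. *)
Lemma pencil_map_block n m (a : 'I_g -> 'M[R]_n) (b : 'I_g -> 'M[R]_(n, m))
    (d : 'I_g -> 'M[R]_m) V W :
  pencil_map A (\row_i block_mx (a i) (b i) 0 (d i)) (row_mx V W) =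
  row_mx (pencil_map A (\row_i a i) V + \sum_i A 0 i *m W *m (b i)^T)
         (pencil_map A (\row_i d i) W + \sum_i (A 0 i)^T *m V *m b i).
Proof.
rewrite /pencil_map -!addrA -!big_split /= -add_row_mx; congr (_ + _).
rewrite -sum_row_mx; apply: eq_bigr => i _.
rewrite !mxE tr_block_mx trmx0 !mul_mx_row !mul_row_block !mulmx0 !add0r !addr0.
rewrite add_row_mx; congr row_mx.
  by rewrite -!addrA; congr (_ + _); rewrite addrC.
by rewrite -!addrA; congr (_ + _); rewrite addrC.
Qed.

End Perturbation.

Section Path.
Variables (R : realType) (g l : nat) (A : mxtuple R g l).

Lemma mxdot_row p n m (a c : 'M[R]_(p, n)) (b d : 'M[R]_(p, m)) :
  mxdot (row_mx a b) (row_mx c d) = mxdot a c + mxdot b d.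
Proof. by rewrite /mxdot tr_row_mx mul_col_row mxtrace_block. Qed.

Lemma pencil_mapZ n (X : mxtuple R g n) a V :
  pencil_map A X (a *: V) = a *: pencil_map A X V.
Proof.
rewrite /pencil_map scalerDr scaler_sumr; congr (_ + _); apply: eq_bigr => i _.
by rewrite -!scalemxAr -!scalemxAl scalerDr.
Qed.

Lemma pencil_map_add n (X : mxtuple R g n) (D : 'I_g -> 'M[R]_n) a V :
  pencil_map A (\row_i (X 0 i + a *: D i)) V =
  pencil_map A X V + a *: \sum_i (A 0 i *m V *m (D i)^T + (A 0 i)^T *m V *m D i).
Proof.
rewrite /pencil_map -addrA; congr (_ + _).
rewrite scaler_sumr -big_split; apply: eq_bigr => i _ /=.
by rewrite !mxE raddfD /= linearZ /= !mulmxDr -!scalemxAr scalerDr addrACA.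
Qed.

Lemma pencil_map_cpmap a (V : 'M[R]_l) :
  pencil_map A (\row_i (a *: A 0 i)) V = V + a *: cpmap (A 0) V.
Proof.
rewrite /pencil_map /cpmap scaler_sumr; congr (_ + _); apply: eq_bigr => i _.
by rewrite mxE linearZ /= -!scalemxAr scalerDr.
Qed.

(** The direct sum of an arbitrary point of V(L) with the point X0 is the end of a
    polynomial path in V(L) that starts in the boundary. *)
Lemma zero_determining_of_generating (i1 : 'I_g) :
    (0 < l)%N -> generates (A 0) -> A 0 i1 \in unitmx ->
    (forall Z, (forall i, Z *m A 0 i + A 0 i *m Z^T = 0) -> Z = 0) ->
  zero_determining (monic_pencil A).
Proof.
move=> l0 gen uA skew; apply: functional_extensionality_dep => n; apply/seteqP; split.
  exact: zero_closure_sub_variety.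
move=> [X v] /= Lv p pI /=.
set V := uncolvec v.
have LV : pencil_map A X V = 0.
  apply: (can_inj (@colvecK _ _ _)).
  by rewrite -monic_pencil_colvec uncolvecK raddf0; exact: Lv.
have [P [lam [Pdef lam0 eigP topP uniqP]]] := perron_frobenius gen l0.
have uP := posdef_unit Pdef.
have P0 : P != 0 by exact: posdef_neq0.
(* The pencil at X0 is 1 - Phi / lam: positive semidefinite, with kernel
   spanned by P. *)
pose X0 : mxtuple R g l := \row_i (- lam^-1 *: A 0 i).
have LX0 W : pencil_map A X0 W = W - lam^-1 *: cpmap (A 0) W.
  by rewrite pencil_map_cpmap scaleNr.
have LX0P : pencil_map A X0 P = 0.
  by rewrite LX0 eigP scalerA mulVf ?scale1r ?subrr// gt_eqF.
pose U := invmx P *m invmx (A 0 i1) *m V.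
have AU : A 0 i1 *m P *m U = V.
  by rewrite /U !mulmxA mulmxK// mulmxV// mul1mx.
have [D HD] := perturbation_surj Pdef skew ((A 0 i1)^T *m V *m U^T).
(* With first block tX, the first columns of the pencil are (t - t^2) V, which
   the term A_1 P b^T cancels; b produces t (t^2 - t) A_1^T V U^T in the last
   columns, which the multiple of D in the last block cancels. Both
   corrections vanish at t = 0 and t = 1. *)
pose a t i := t *: X 0 i.
pose b t i := ((t ^+ 2 - t) * (i == i1)%:R) *: U^T.
pose d t i := X0 0 i + (t ^+ 2 - t ^+ 3) *: D i.
pose Y t : mxtuple R g (n + l) := \row_i block_mx (a t i) (b t i) 0 (d t i).
pose W t := row_mx (t *: V) P.
have LY t : pencil_map A (Y t) (W t) = 0.
  rewrite pencil_map_block pencil_mapZ pencil_map_scale LV scaler0 addr0.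
  rewrite pencil_map_add LX0P add0r HD.
  rewrite (bigD1 i1)//= [X in _ + (_ + X)]big1 ?addr0; last first.
    by move=> i /negPf ii; rewrite /b ii mulr0 scale0r trmx0 mulmx0.
  rewrite (bigD1 i1)//= [X in row_mx _ (_ + (_ + X))]big1 ?addr0; last first.
    by move=> i /negPf ii; rewrite /b ii mulr0 scale0r mulmx0.
  rewrite /b eqxx mulr1 [(_ *: U^T)^T]linearZ /= trmxK -!scalemxAr AU.
  rewrite -scalemxAl !scalerA -!scalerDl.
  rewrite (_ : t * (1 - t) + (t ^+ 2 - t) = 0); last by ring.
  rewrite (_ : t ^+ 2 - t ^+ 3 + (t ^+ 2 - t) * t = 0); last by ring.
  by rewrite !scale0r row_mx0.
have LY0 V1 V2 : pencil_map A (Y 0) (row_mx V1 V2) = row_mx V1 (pencil_map A X0 V2).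
  rewrite pencil_map_block pencil_map_scale subr0 scale1r scale0r addr0.
  rewrite pencil_map_add !expr0n subrr scale0r addr0 !big1 ?addr0// => i _.
    by rewrite /b expr0n subr0 mul0r scale0r mulmx0.
  by rewrite /b expr0n subr0 mul0r scale0r trmx0 mulmx0.
have polyY i : polymx (fun t => Y t 0 i).
  have -> : (fun t => Y t 0 i) = (fun t => block_mx (a t i) (b t i) 0 (d t i)).
    by apply/funext => t; rewrite mxE.
  apply: polymx_block; last 1 first.
  - apply: polymxD; first exact: polymx_cst.
    by apply: (polymx_scale (q := 'X^2 - 'X^3)) => t; rewrite !hornerE.
  - by apply: (polymx_scale (q := 'X)) => t; rewrite hornerX.
  - apply: (polymx_scale (q := ('X^2 - 'X) * ((i == i1)%:R)%:P)) => t.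
    by rewrite !hornerE.
  - exact: polymx_cst.
have polyW : polymx (fun t => colvec (W t)).
  apply/polymx_colvec/polymx_row; last exact: polymx_cst.
  by apply: (polymx_scale (q := 'X)) => t; rewrite hornerX.
have formL (u : 'M[R]_(l, n)) (w : 'M[R]_l) :
    mxdot (colvec (row_mx u w)) (nceval (monic_pencil A) (Y 0) *m colvec (row_mx u w)) =
    mxdot u u + lam^-1 * (lam * mxdot w w - mxdot w (cpmap (A 0) w)).
  rewrite monic_pencil_colvec mxdot_colvec LY0 mxdot_row LX0 mxdotBr mxdotZr.
  by rewrite mulrBr mulKf// gt_eqF.
have form_ge0 w : 0 <= lam^-1 * (lam * mxdot w w - mxdot w (cpmap (A 0) w)).
  by rewrite mulr_ge0 ?invr_ge0 ?(ltW lam0)// subr_ge0 topP.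
have [||||||e e0 psdY] := @simple_kernel_stable R _
   (fun t => nceval (monic_pencil A) (Y t)) (fun t => colvec (W t)).
- exact: polymx_nceval.
- by move=> t; exact: monic_pencil_sym.
- by move=> t; rewrite monic_pencil_colvec LY raddf0.
- move=> t; rewrite mxdot_colvec mxdot_row mxdotZl mul0r add0r.
  exact: mxdot_gt0.
- move=> u; rewrite -(uncolvecK u) -(hsubmxK (uncolvec u)) formL.
  by rewrite addr_ge0 ?mxdot_ge0.
- move=> u; rewrite -(uncolvecK u) -(hsubmxK (uncolvec u)) formL.
  set u1 := lsubmx _; set u2 := rsubmx _ => /eqP.
  rewrite paddr_eq0 ?mxdot_ge0// => /andP[/eqP /mxdot_eq0 -> ].
  rewrite mulf_eq0 invr_eq0 (gt_eqF lam0) /= subr_eq0 => /eqP /esym /uniqP[c ->].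
  by exists c; rewrite -linearZ /= scale_row_mx scale0r scaler0.
have pY t : `|t| < e -> nceval p (Y t) *m colvec (W t) = 0.
  move=> te; apply: (pI _ (Y t, colvec (W t))).
  by apply: psd_boundary; [exact: psdY|rewrite monic_pencil_colvec LY raddf0].
have := polymx_eq0 (polymx_mul (polymx_nceval p polyY) polyW) e0 pY 1.
rewrite /W scale1r (_ : Y 1 = tuple_dsum X X0); last first.
  apply/matrixP => i j; rewrite !mxE /a /b /d !expr1n subrr mul0r !scale0r addr0.
  by rewrite scale1r mxE.
by move=> /nceval_tuple_dsum_eq0; rewrite uncolvecK.
Qed.

End Path.

(** * Genericity *)

Section Words.

Definition mx_pow (S : comNzRingType) l (B : 'M[S]_l) i := iter i (mulmx B) 1%:M.

(** The l^2 words B^i C B^j, i, j < l, as the rows of a square matrix: if it is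
    invertible then these words are a basis of the matrix algebra. *)
Definition word_mx (S : comNzRingType) l (B C : 'M[S]_l) : 'M[S]_(l * l) :=
  \matrix_(r, c) (mx_pow B (mxtens_unindex r).1 *m C *m mx_pow B (mxtens_unindex r).2)
    (mxtens_unindex c).1 (mxtens_unindex c).2.

Lemma map_mx_pow (S T : comNzRingType) (f : {rmorphism S -> T}) l (B : 'M[S]_l) i :
  map_mx f (mx_pow B i) = mx_pow (map_mx f B) i.
Proof. by elim: i => [|i IH] /=; rewrite ?map_mx1// map_mxM IH. Qed.

Lemma map_word_mx (S T : comNzRingType) (f : {rmorphism S -> T}) l (B C : 'M[S]_l) :
  map_mx f (word_mx B C) = word_mx (map_mx f B) (map_mx f C).
Proof.
apply/matrixP => r c; rewrite [LHS]mxE [word_mx _ _ _ _]mxE [RHS]mxE.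
by rewrite -!map_mx_pow -!map_mxM [RHS]mxE.
Qed.

Lemma word_mx_span (F : fieldType) l (B C : 'M[F]_l) : word_mx B C \in unitmx ->
  forall S : set 'M[F]_l, S B -> S C ->
    (forall a U V, S U -> S V -> S (a *: U + V)) ->
    (forall U V, S U -> S V -> S (U *m V)) -> forall W, S W.
Proof.
move=> uG S SB SC Slin Smul W.
have S0 : S 0 by have := Slin (-1) _ _ SB SB; rewrite scaleN1r addNr.
have SBi i U : S U -> S (mx_pow B i *m U).
  by move=> SU; elim: i => [|i IH] /=; rewrite ?mul1mx// -mulmxA; exact: Smul.
have SBj j U : S U -> S (U *m mx_pow B j).
  elim: j U => [|j IH] U SU /=; first by rewrite mulmx1.
  by rewrite mulmxA; apply: IH; exact: Smul.
pose w : 'rV[F]_(l * l) := \row_c W (mxtens_unindex c).1 (mxtens_unindex c).2.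
pose u := w *m invmx (word_mx B C).
have -> : W = \sum_r u 0 r *:
    (mx_pow B (mxtens_unindex r).1 *m C *m mx_pow B (mxtens_unindex r).2).
  apply/matrixP => i j; rewrite summxE.
  have /matrixP/(_ 0 (mxtens_index (i, j))) := mulmxKV uG w.
  rewrite mxE [w _ _]mxE mxtens_indexK /= => <-; apply: eq_bigr => r _.
  by rewrite !mxE mxtens_indexK.
apply: (big_ind S) => // [U V SU SV|r _]; first by rewrite -[U]scale1r; exact: Slin.
rewrite -[_ *: _]addr0; apply: Slin => //.
by apply: SBj; exact: SBi.
Qed.

(** With J the all-ones matrix, the entries of D^i J D^j are d_a^i d_b^j. *)
Lemma word_mx_diag_ones (F : fieldType) l (d : 'rV[F]_l) : (0 < l)%N ->
  (forall i j, i != j -> d 0 i != d 0 j) ->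
  word_mx (diag_mx d) (const_mx 1) \in unitmx.
Proof.
move=> l0 dinj.
have -> : word_mx (diag_mx d) (const_mx 1) = Vandermonde l d *t Vandermonde l d.
  have powE i : mx_pow (diag_mx d) i = diag_mx (map_mx (fun x => x ^+ i) d).
    elim: i => [|i IH] /=; first by apply/matrixP => a b; rewrite !mxE expr0.
    by rewrite IH mul_diag_mx; apply/matrixP => a b; rewrite !mxE exprS mulrnAr.
  apply/matrixP => r c; rewrite [LHS]mxE !powE mul_diag_mx mul_mx_diag !mxE.
  by rewrite mulr1.
have uV : Vandermonde l d \in unitmx.
  rewrite unitmxE det_Vandermonde unitfE.
  apply/prodf_neq0 => i _; apply/prodf_neq0 => j ij.
  by rewrite subr_eq0; apply: dinj; rewrite gt_eqF.
by apply: tensmx_unit => //; rewrite -lt0n.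
Qed.

End Words.

Section SkewEquation.
Variables (R : realType) (l : nat).

(** Eliminating Z^T between the equations for B and A_k shows that Z commutes
    with A_k B^{-1}; the adjugate replaces the inverse to keep everything
    polynomial. Thus Z is central; the equation for B then reads Z^T = - Z, and
    a central skew-symmetric matrix is zero. *)
Lemma skew_eq0_of_word_mx (B A2 A3 : 'M[R]_l) : B \in unitmx ->
    word_mx (A2 *m \adj B) (A3 *m \adj B) \in unitmx ->
  forall Z, Z *m B + B *m Z^T = 0 -> Z *m A2 + A2 *m Z^T = 0 ->
    Z *m A3 + A3 *m Z^T = 0 -> Z = 0.
Proof.
move=> uB uw Z ZB ZA2 ZA3.
have detB : \det B != 0 by rewrite -unitfE -unitmxE.
have ZTadj : Z^T *m \adj B = - (\adj B *m Z).
  have BZ : B *m Z^T = - (Z *m B) by apply/eqP; rewrite -addr_eq0 addrC ZB.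
  have : \adj B *m B *m (Z^T *m \adj B) = - (\adj B *m Z *m (B *m \adj B)).
    by rewrite -mulmxA (mulmxA B) BZ mulNmx mulmxN !mulmxA.
  rewrite mul_adj_mx mul_mx_adj mul_scalar_mx mul_mx_scalar -scalerN.
  exact: scalerI.
have comm A : Z *m A + A *m Z^T = 0 -> Z *m (A *m \adj B) = (A *m \adj B) *m Z.
  move=> ZA; have -> : Z *m (A *m \adj B) = - (A *m Z^T *m \adj B).
    by rewrite mulmxA -mulNmx; congr (_ *m _); apply/eqP; rewrite -addr_eq0 ZA.
  by rewrite -mulmxA ZTadj mulmxN opprK mulmxA.
have central : forall W, Z *m W = W *m Z.
  apply: (word_mx_span uw) => [||a U V ZU ZV|U V ZU ZV]; try exact: comm.
    by rewrite mulmxDr mulmxDl -scalemxAl -scalemxAr ZU ZV.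
  by rewrite mulmxA ZU -mulmxA ZV mulmxA.
have ZT : Z^T = - Z.
  apply/eqP; rewrite -addr_eq0 addrC; apply/eqP.
  by rewrite -[LHS](mulKmx uB) mulmxDr -(central B) ZB mulmx0.
have diag i : Z i i = 0.
  have /matrixP/(_ i i) := ZT; rewrite !mxE => /eqP.
  by rewrite -subr_eq0 opprK -mulr2n mulrn_eq0 => /eqP.
apply/matrixP => i j; rewrite mxE.
have /matrixP/(_ i j) := central (delta_mx j (0 : 'I_1) *m delta_mx 0 j).
rewrite (mulmxA Z) -colE -(mulmxA (delta_mx j 0)) -rowE !mxE !big_ord1 !mxE.
by rewrite !eqxx mulr1 diag mulr0.
Qed.

End SkewEquation.

Section Generic.
Variables (R : realType) (g l : nat).
Variables i1 i2 i3 : 'I_g.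
Hypotheses (i12 : i1 != i2) (i13 : i1 != i3) (i23 : i2 != i3).

Local Notation N := #|entry_index g l|.
Local Notation MP := (mpoly N R).

Definition generic_poly (S : comNzRingType) (A1 A2 A3 : 'M[S]_l) : S :=
  \det A1 * \det (word_mx A2 A3) * \det (word_mx (A2 *m \adj A1) (A3 *m \adj A1)).

Lemma map_generic_poly (S T : comNzRingType) (f : {rmorphism S -> T}) A1 A2 A3 :
  f (generic_poly A1 A2 A3) =
  generic_poly (map_mx f A1) (map_mx f A2) (map_mx f A3).
Proof.
by rewrite /generic_poly !rmorphM /= -!det_map_mx !map_word_mx !map_mxM !map_mx_adj.
Qed.

Definition generic_mx (k : 'I_g) : 'M[MP]_l :=
  \matrix_(a, b) mpolyX R (mnm1 (enum_rank ((k, (a, b)) : entry_index g l))).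

Lemma map_generic_mx (A : mxtuple R g l) k :
  map_mx (meval (entries A)) (generic_mx k) = A 0 k.
Proof.
by apply/matrixP => a b; rewrite !mxE mevalXU /entries enum_rankK.
Qed.

(** The polynomial is [generic_poly] of matrices of indeterminates; it is not
    identically zero because of the tuple given by [word_mx_diag_ones]. *)
Lemma generically_of (Q : mxtuple R g l -> Prop) : (0 < l)%N ->
  (forall A : mxtuple R g l, generic_poly (A 0 i1) (A 0 i2) (A 0 i3) != 0 -> Q A) ->
  generically Q.
Proof.
move=> l0 h.
pose f := generic_poly (generic_mx i1) (generic_mx i2) (generic_mx i3).
have fE A : meval (entries A) f = generic_poly (A 0 i1) (A 0 i2) (A 0 i3).
  by rewrite /f map_generic_poly !map_generic_mx.
exists [set A | forall p, [set f] p -> meval (entries A) p = 0]; split.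
- by exists [set f].
- pose d : 'rV[R]_l := \row_j (j : nat)%:R.
  pose A : mxtuple R g l :=
    \row_k (if k == i1 then 1%:M else if k == i2 then diag_mx d else const_mx 1).
  move=> /seteqP[_ /(_ A Logic.I) /= /(_ f erefl)]; rewrite fE !mxE eqxx.
  rewrite eq_sym (negPf i12) eqxx eq_sym (negPf i13) eq_sym (negPf i23).
  apply/eqP.
  have uw : word_mx (diag_mx d) (const_mx 1) \in unitmx.
    by apply: word_mx_diag_ones => // i j; rewrite !mxE eqr_nat.
  rewrite /generic_poly adj1 !mulmx1 det1 mul1r.
  by rewrite mulf_neq0// -unitfE -unitmxE.
- move=> A nA; apply: h; apply/eqP; rewrite -fE => fA0; apply: nA => /= p ->.
  exact: fA0.
Qed.

End Generic.

Theorem corollary5p6 (R : realType) (g l : nat) (hg : (2 < g)%N) :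
  generically (fun A : mxtuple R g l => zero_determining (monic_pencil A)).
Proof.
have [l0|l0] := posnP l.
  (* The ambient vector space is zero. *)
  subst l; exists set0; split; last 1 first.
  - move=> A _; apply: functional_extensionality_dep => n; apply/seteqP; split=> -[X v] _.
      by apply/matrixP => -[].
    by move=> p _; apply/matrixP => i j; rewrite !mxE big1// => -[].
  - exists [set 1]; apply/seteqP; split=> // A /(_ 1 erefl) /eqP.
    by rewrite meval1 oner_eq0.
  - by move=> /seteqP[_ /(_ 0 Logic.I)].
pose i1 : 'I_g := Ordinal (ltn_trans (ltn0Sn 1) hg).
pose i2 : 'I_g := Ordinal (ltn_trans (ltnSn 1) hg).
pose i3 : 'I_g := Ordinal hg.
apply: (@generically_of R g l i1 i2 i3) => // A.
rewrite /generic_poly !mulf_eq0 !negb_or => /andP[/andP[d1 dw] dw'].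
have u1 : A 0 i1 \in unitmx by rewrite unitmxE unitfE.
apply: (@zero_determining_of_generating R g l A i1) => //.
  move=> S SA Slin Smul; apply: (@word_mx_span _ _ (A 0 i2) (A 0 i3)) => //.
  by rewrite unitmxE unitfE.
move=> Z skewZ; apply: (@skew_eq0_of_word_mx R l (A 0 i1) (A 0 i2) (A 0 i3)) => //.
by rewrite unitmxE unitfE.
Qed.
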